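(* Let $I\subseteq R=k[x_1,\ldots,x_n]$ be a monomial ideal and let $I^{\mathscr{P}}\subseteq S$ be the polarization of $I$. The following are equivalent: (i) $I^{\mathscr{P}}$ is a tame squarefree monomial ideal in $S$; (ii) there exist a monomial $u\in R$ and a tame squarefree monomial ideal $I'\subseteq R$ such that $I=uI'$. In particular, if $I^{\mathscr{P}}$ is tame, then so is $I$.
   Context: Let $k$ be an algebraically closed field. An ideal $I$ of a polynomial ring $A$ over $k$ in finitely many variables is called tame if the blowup $\mathrm{Proj}\big(\bigoplus_{i\ge 0}I^it^i\big)$ of $\mathrm{Spec}(A)$ along $I$ is regular. Polarization: let $I\subseteq R=k[x_1,\ldots,x_n]$ be a monomial ideal with minimal set of monomial generators $\mathcal{G}(I)=\{u_1,\ldots,u_r\}$, $u_i=\prod_{j=1}^n x_j^{\alpha_{i,j}}$. Let $\alpha_j$ be the maximum exponent of $x_j$ appearing in elements of $\mathcal{G}(I)$, and let $S=R[Y_{j,l} : 1\le j\le n,\ 2\le l\le\alpha_j]$. For each $i$ put $$u_i^{\mathscr{P}}=\prod_{j=1}^n\Big(x_j^{\min\{\alpha_{i,j},1\}}\,Y_{j,2}Y_{j,3}\cdots Y_{j,\alpha_{i,j}}\Big)\in S,$$ where the product $Y_{j,2}\cdots Y_{j,\alpha_{i,j}}$ is empty (equal to 1) if $\alpha_{i,j}\le 1$. The polarization $I^{\mathscr{P}}$ is the ideal of $S$ generated by $u_1^{\mathscr{P}},\ldots,u_r^{\mathscr{P}}$. *)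

(* Defs.v *)
From mathcomp Require Export all_boot all_algebra.
From mathcomp Require Export boolp classical_sets.
From mathcomp Require Export mpoly.

Set Implicit Arguments.
Unset Strict Implicit.
Unset Printing Implicit Defensive.

Import GRing.Theory.

Local Open Scope classical_set_scope.
Local Open Scope ring_scope.

(* Commutative algebra in a subring B of a commutative ring T.  The rings
   needed below (Rees algebras and the local rings of their Proj) all occur as
   subrings; the case of T itself is B = setT. *)
Section Subring.
Variable T : comNzRingType.
Implicit Types B E J P M : set T.

Definition span B E : set T :=
  [set x | exists (m : nat) (c e : 'I_m -> T),
     (forall i, B (c i) /\ E (e i)) /\ x = \sum_(i < m) c i * e i].

Definition is_ideal B J : Prop :=
  [/\ J `<=` B, J 0, forall x y, J x -> J y -> J (x + y)
    & forall b x, B b -> J x -> J (b * x)].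

Definition is_prime_ideal B P : Prop :=
  [/\ is_ideal B P, ~ P 1
    & forall x y, B x -> B y -> P (x * y) -> P x \/ P y].

Definition is_maximal_ideal B M : Prop :=
  [/\ is_ideal B M, ~ M 1
    & forall J, is_ideal B J -> M `<=` J -> J 1 \/ J = M].

Definition noetherian B : Prop :=
  forall J, is_ideal B J ->
    exists (m : nat) (a : 'I_m -> T), J = span B (range a).

Definition is_local_ring B M : Prop :=
  is_maximal_ideal B M /\ forall M', is_maximal_ideal B M' -> M' = M.

Definition has_prime_chain B (d : nat) : Prop :=
  exists P : nat -> set T,
    (forall i, (i <= d)%N -> is_prime_ideal B (P i)) /\
    (forall i, (i < d)%N -> P i `<` P i.+1).

Definition krull_dim B (d : nat) : Prop :=
  has_prime_chain B d /\ forall d', has_prime_chain B d' -> (d' <= d)%N.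

Definition regular_local_ring B : Prop :=
  [/\ GRing.subring_closed (mem B), noetherian B
    & exists M, is_local_ring B M /\
        exists d, krull_dim B d /\
          exists a : 'I_d -> T, M = span B (range a)].

End Subring.

Definition ideal_gen (A : comNzRingType) (E : set A) : set A := span setT E.

Fixpoint ideal_pow (A : comNzRingType) (I : set A) (i : nat) : set A :=
  if i is i'.+1 then
    ideal_gen [set x * y | x in I & y in ideal_pow I i']
  else setT.

Section Blowup.
Variable A : idomainType.
Implicit Types (I : set A) (P : set {poly A}).

(* The variable 'X of {poly A} plays the role of t. *)
Definition rees I : set {poly A} :=
  [set p | forall i, ideal_pow I i p`_i].

Definition irrelevant_ideal I : set {poly A} :=
  [set p | rees I p /\ p`_0 = 0].

Definition is_homogeneous P : Prop :=
  forall p, P p -> forall i, P (p`_i *: 'X^i).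

Definition blowup_point I P : Prop :=
  [/\ is_prime_ideal (rees I) P, is_homogeneous P
    & ~ irrelevant_ideal I `<=` P].

(* The stalk of the structure sheaf of Proj (rees I) at P: the degree 0 part
   of the localization of rees I at its homogeneous elements outside P.  As
   rees I is a domain, this localization embeds in the fraction field. *)
Definition blowup_stalk I P : set {fraction {poly A}} :=
  [set z | exists (i : nat) (a b : A),
     [/\ ideal_pow I i a, ideal_pow I i b, ~ P (b *: 'X^i)
       & z = tofrac (a *: 'X^i) / tofrac (b *: 'X^i)]].

(* When I = 0 the blowup is empty, hence regular. *)
Definition tame I : Prop :=
  forall P, blowup_point I P -> regular_local_ring (blowup_stalk I P).

End Blowup.

Section MonomialIdeals.
Variables (k : fieldType) (n : nat).
Implicit Type I : set {mpoly k[n]}.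

Definition monomial_ideal I : Prop :=
  exists M : set 'X_{1..n}, I = ideal_gen [set 'X_[m] | m in M].

Definition squarefree_monomial_ideal I : Prop :=
  exists M : set 'X_{1..n},
    (forall m, M m -> forall j, (m j <= 1)%N) /\
    I = ideal_gen [set 'X_[m] | m in M].

(* The second condition also forces the u i to be pairwise distinct. *)
Definition minimal_monomial_generators I (r : nat) (u : 'I_r -> 'X_{1..n}) :
    Prop :=
  I = ideal_gen [set 'X_[u i] | i in [set: 'I_r]] /\
  forall i, ~ ideal_gen [set 'X_[u i'] | i' in [set i' | i' != i]]
              ('X_[u i] : {mpoly k[n]}).

End MonomialIdeals.

Section Polarization.
Variables (n r : nat) (u : 'I_r -> 'X_{1..n}).

Definition max_exponent (j : 'I_n) : nat := \max_(i < r) u i j.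

(* Indices of the variables of S: inl j stands for x_j, and inr (j, l) for
   Y_{j,l+2}, where 0 <= l < max_exponent j - 1. *)
Definition pol_index : finType :=
  ('I_n + {j : 'I_n & 'I_(max_exponent j).-1})%type.

Definition pol_nvars : nat := #|pol_index|.

Variable k : fieldType.

Definition pol_x (j : 'I_n) : {mpoly k[pol_nvars]} :=
  'X_(enum_rank (inl j : pol_index)).

Definition pol_Y (j : 'I_n) (l : 'I_(max_exponent j).-1) :
    {mpoly k[pol_nvars]} :=
  'X_(enum_rank (inr (existT _ j l) : pol_index)).

Definition pol_monomial (i : 'I_r) : {mpoly k[pol_nvars]} :=
  \prod_(j < n) (pol_x j ^+ minn (u i j) 1 *
                 \prod_(l < (max_exponent j).-1 | (l.+2 <= u i j)%N) pol_Y l).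

Definition polarization : set {mpoly k[pol_nvars]} :=
  ideal_gen (range pol_monomial).

End Polarization.

Arguments pol_x {n r} u k j.
Arguments pol_Y {n r} u k j l.
Arguments pol_monomial {n r} u k i.
Arguments polarization {n r} u k _.

(* Main.v *)
(* Let W be the antichain of supports of the minimal generators of a squarefree
   monomial ideal.  Tameness is equivalent to two combinatorial conditions: if c
   is in W i but not in W l, then some W g not containing c satisfies
   W g \ W i = {d} with d in W l (exchange), and a g with W g \ W i = {d} is
   determined by i and d (unique_exchange).

   The monoid generated by the X_c and the X_(W l) / X_(W i) is pointed, so the
   chart at i has a torus-fixed point.  Its local ring has dimension at most n,
   by counting algebraically independent elements, while its cotangent space has
   a basis indexed by the irreducible elements of the monoid.  If the blowup is
   regular, there are hence at most n of them, and this forces both conditions.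
   Conversely, under these conditions, the chart at i is a polynomial ring in
   variables X_c or X_c / X_d, also when all generators are multiplied by a
   common monomial, and every localization of a polynomial ring is regular.

   Applied to the polarization, exchange shows that the exponents of each
   variable x_j in the generators take at most two values m_j and m_j + 1: if
   they jump by 2, two consecutive variables y, z of the polarization of x_j lie
   in the support W f of a generator while y is not in some W v; exchange gives
   W g with W g \ W f a single element and y, hence z, not in W g; by exchange
   again W f \ W g is a single element, which is absurd.  So the ideal is u I'
   with I' squarefree, and the two conditions for I' and for the polarization
   are the same, because the supports differ only by renaming the variables
   and by variables common to all generators. *)

Require Import Defs.
From mathcomp Require Import ring zify.

Set Implicit Arguments.
Unset Strict Implicit.
Unset Printing Implicit Defensive.

Import GRing.Theory.
Local Open Scope classical_set_scope.
Local Open Scope ring_scope.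

(** * Finitely generated ideals and the Hilbert basis theorem *)

Section IdealsOfSubrings.
Variable T : comNzRingType.
Implicit Types (B E J K P : set T) (s : seq T).

Definition subring_set B : Prop :=
  [/\ B 1, forall x y, B x -> B y -> B (x - y)
    & forall x y, B x -> B y -> B (x * y)].

Lemma subring_setT : subring_set setT. Proof. by []. Qed.

Lemma subring_set_closed B : subring_set B -> GRing.subring_closed (mem B).
Proof.
case=> B1 BB BM; split=> [|x y|x y]; first by rewrite in_setE.
- by rewrite !in_setE; apply: BB.
- by rewrite !in_setE; apply: BM.
Qed.

Section Closure.
Variables (B : set T) (hB : subring_set B).

Lemma subring_set0 : B 0.
Proof. by case: hB => B1 BB _; rewrite -(subrr 1); apply: BB. Qed.

Lemma subring_setN x : B x -> B (- x).
Proof.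
by case: hB => _ BB _ Bx; rewrite -[- x]add0r; apply/BB/Bx/subring_set0.
Qed.

Lemma subring_setD x y : B x -> B y -> B (x + y).
Proof.
by case: hB => _ BB _ Bx By; rewrite -[y]opprK; apply/BB/subring_setN.
Qed.

Lemma subring_setX x m : B x -> B (x ^+ m).
Proof.
by case: hB => B1 _ BM Bx; elim: m => // m IHm; rewrite exprS; apply: BM.
Qed.

Lemma subring_set_sum (U : Type) (r : seq U) (F : U -> T) :
  (forall i, B (F i)) -> B (\sum_(i <- r) F i).
Proof.
move=> BF; elim/big_rec: _ => [|i x _ Bx]; first exact: subring_set0.
exact: subring_setD.
Qed.

Lemma subring_set_prod (U : Type) (r : seq U) (Q : pred U) (F : U -> T) :
  (forall i, Q i -> B (F i)) -> B (\prod_(i <- r | Q i) F i).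
Proof.
case: hB => B1 _ BM BF; elim/big_rec: _ => // i x Qi Bx; exact/BM/Bx/BF.
Qed.

End Closure.

Section IdealClosure.
Variables (B J : set T) (hJ : is_ideal B J).

Lemma ideal0 : J 0. Proof. by case: hJ. Qed.

Lemma idealD x y : J x -> J y -> J (x + y).
Proof. by case: hJ => _ _ + _; apply. Qed.

Lemma idealMl b x : B b -> J x -> J (b * x).
Proof. by case: hJ => _ _ _; apply. Qed.

Lemma idealMr b x : B b -> J x -> J (x * b).
Proof. by rewrite mulrC; apply: idealMl. Qed.

Lemma ideal_sub x : J x -> B x. Proof. by case: hJ => + _ _ _; apply. Qed.

Lemma ideal_sum (U : Type) (r : seq U) (Q : pred U) (F : U -> T) :
  (forall i, Q i -> J (F i)) -> J (\sum_(i <- r | Q i) F i).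
Proof.
move=> JF; elim/big_rec: _ => [|i x Qi Jx]; first exact: ideal0.
exact/idealD/Jx/JF.
Qed.

Hypothesis hB : subring_set B.

Lemma idealN x : J x -> J (- x).
Proof.
by case: (hB) => B1 _ _ Jx; rewrite -mulN1r; apply: idealMl => //; apply: subring_setN.
Qed.

Lemma idealB x y : J x -> J y -> J (x - y).
Proof. by move=> Jx Jy; apply/idealD/idealN. Qed.

End IdealClosure.

Lemma prime_ideal_ideal B P : is_prime_ideal B P -> is_ideal B P.
Proof. by case. Qed.

Lemma prime_idealX B P x m :
  subring_set B -> is_prime_ideal B P -> B x -> P (x ^+ m) -> P x.
Proof.
move=> hB [iP P1 PM] Bx; elim: m => [|m IHm]; first by rewrite expr0.
by rewrite exprS => /PM[] //; apply: subring_setX.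
Qed.

Lemma prime_notM B P x y : is_prime_ideal B P -> B x -> B y ->
  ~ P x -> ~ P y -> ~ P (x * y).
Proof. by move=> [_ _ PM] Bx By Px Py /PM[]. Qed.

Lemma prime_prod_notin B P (U : Type) (r : seq U) (F : U -> T) :
  subring_set B -> is_prime_ideal B P -> (forall i, B (F i) /\ ~ P (F i)) ->
  ~ P (\prod_(i <- r) F i).
Proof.
move=> hB hP hF; elim: r => [|i r IHr]; first by rewrite big_nil; case: hP.
have [BFi PFi] := hF i; rewrite big_cons; apply: (prime_notM hP) => //.
by apply: (subring_set_prod hB) => j _; case: (hF j).
Qed.

Lemma is_ideal_zero : is_ideal setT [set (0 : T)].
Proof.
by split=> // [x y /= -> ->|b x _ /= ->]; rewrite ?addr0 ?mulr0.
Qed.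

Lemma mem_span B E x : B 1 -> E x -> span B E x.
Proof.
move=> B1 Ex; exists 1%N, (fun=> 1), (fun=> x); split=> //.
by rewrite big_ord1 mul1r.
Qed.

Lemma span_min B E J : is_ideal B J -> E `<=` J -> span B E `<=` J.
Proof.
move=> hJ EJ _ [m [c [e [ce ->]]]]; apply: (ideal_sum hJ) => i _.
by have [Bc /EJ Je] := ce i; apply: (idealMl hJ).
Qed.

Lemma span_ideal B E : subring_set B -> E `<=` B -> is_ideal B (span B E).
Proof.
move=> hB EB; case: (hB) => B1 _ BM; split.
- move=> _ [m [c [e [ce ->]]]]; apply: (subring_set_sum hB) => i.
  by have [Bc /EB Be] := ce i; apply: BM.
- exists 0%N, (fun=> 0), (fun=> 0); split=> [[]//|].
  by rewrite big_ord0.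
- move=> _ _ [m [c [e [ce ->]]]] [m' [c' [e' [ce' ->]]]].
  exists (m + m')%N, (fun i => match split i with inl j => c j | inr j => c' j end),
    (fun i => match split i with inl j => e j | inr j => e' j end); split.
    by move=> i; case: (split i).
  rewrite big_split_ord /=; congr (_ + _); apply: eq_bigr => i _.
    by rewrite (unsplitK (inl i : 'I_m + 'I_m')).
  by rewrite (unsplitK (inr i : 'I_m + 'I_m')).
- move=> b _ Bb [m [c [e [ce ->]]]].
  exists m, (fun i => b * c i), e; split=> [i|].
    by have [Bc Ee] := ce i; split=> //; apply: BM.
  by rewrite mulr_sumr; apply: eq_bigr => i _; rewrite mulrA.
Qed.

(** Generation by a finite list, phrased through the ideals that contain it; proofs then check
    closure properties of [K] and never handle linear combinations. *)
Definition fgen B J : Prop := exists s, (forall x, x \in s -> J x) /\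
  forall K, is_ideal B K -> (forall x, x \in s -> K x) -> J `<=` K.

Lemma span_range_nth B J s : subring_set B -> is_ideal B J ->
  (forall x, x \in s -> J x) ->
  (forall K, is_ideal B K -> (forall x, x \in s -> K x) -> J `<=` K) ->
  J = span B (range (fun i : 'I_(size s) => s`_i)).
Proof.
move=> hB hJ sJ smin; have B1 : B 1 by case: hB.
apply/seteqP; split.
  apply: smin => [|x xs].
    apply: span_ideal => // _ [i _ <-]; apply/(ideal_sub hJ)/sJ/mem_nth/ltn_ord.
  apply: mem_span => //; have ix : (index x s < size s)%N by rewrite index_mem.
  by exists (Ordinal ix) => //=; rewrite nth_index.
by apply: span_min => // _ [i _ <-]; apply/sJ/mem_nth/ltn_ord.
Qed.

Lemma fgen_span B J : subring_set B -> is_ideal B J -> fgen B J ->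
  exists m (a : 'I_m -> T), J = span B (range a).
Proof.
move=> hB hJ [s [sJ smin]]; exists (size s), (fun i => s`_i).
exact: span_range_nth.
Qed.

Lemma span_fgen B m (a : 'I_m -> T) : B 1 -> fgen B (span B (range a)).
Proof.
move=> B1; exists (codom a); split=> [_ /codomP[i ->]|K hK aK].
  by apply: mem_span => //; exists i.
by apply: span_min => // _ [i _ <-]; apply/aK/codom_f.
Qed.

Lemma noetherianP B : subring_set B ->
  noetherian B <-> (forall J, is_ideal B J -> fgen B J).
Proof.
move=> hB; split=> noB J hJ; last exact/fgen_span/noB.
by have [m [a ->]] := noB J hJ; apply: span_fgen; case: hB.
Qed.

End IdealsOfSubrings.

Lemma field_noetherian (k : fieldType) : noetherian [set: k].
Proof.
apply/noetherianP=> // J hJ.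
have [[x Jx x0]|J0] := pselect (exists2 x, J x & x != 0).
  exists [:: x]; split=> [y|K hK Kx y _]; first by rewrite inE => /eqP ->.
  by rewrite -[y](mulfVK x0); apply: (idealMl hK) => //; apply: Kx; rewrite inE.
exists [::]; split=> // K hK _ x Jx; have [->|x0] := eqVneq x 0.
  exact: ideal0 hK.
by case: J0; exists x.
Qed.

Section HilbertBasis.
Variables (A : comNzRingType) (nA : noetherian [set: A]).
Variables (J : set {poly A}) (hJ : is_ideal setT J).

(** The leading coefficients of the members of [J] of degree [i]. The bound on the size is not
    strict, so that 0 belongs to it and it is an ideal. *)
Let lead i : set A := [set c | exists p, [/\ J p, (size p <= i.+1)%N & p`_i = c]].

Let lead_mono i j : (i <= j)%N -> lead i `<=` lead j.
Proof.
move=> ij _ [p [Jp sp <-]]; exists (p * 'X^(j - i)); split.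
- exact: (idealMr hJ).
- have [->|p0] := eqVneq p 0; first by rewrite mul0r size_poly0.
  by rewrite size_mulXn //; lia.
- by rewrite coefMXn ltnNge leq_subr subKn.
Qed.

Let lead_ideal i : is_ideal setT (lead i).
Proof.
split=> //.
- by exists 0; rewrite size_poly0 coef0; split=> //; apply: ideal0 hJ.
- move=> _ _ [p [Jp sp <-]] [q [Jq sq <-]]; exists (p + q); rewrite coefD.
  split=> //; first exact: (idealD hJ).
  by rewrite (leq_trans (size_polyD _ _)) // geq_max sp.
- move=> b _ _ [p [Jp sp <-]]; exists (b%:P * p); rewrite coefCM; split=> //.
    exact: (idealMl hJ).
  by rewrite mul_polyC (leq_trans (size_scale_leq _ _)).
Qed.

Let leads_ideal : is_ideal setT [set c | exists i, lead i c].
Proof.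
split=> //; first by exists 0%N; apply: ideal0 (lead_ideal 0).
- move=> x y [i xi] [j yj]; exists (maxn i j); apply: (idealD (lead_ideal _)).
    exact/(lead_mono (leq_maxl _ _)).
  exact/(lead_mono (leq_maxr _ _)).
- by move=> b x _ [i xi]; exists i; apply: (idealMl (lead_ideal i)).
Qed.

(** The ascending union of the [lead i] is a finitely generated ideal, and its finitely many
    generators all lie in one [lead N]. *)
Let leads_stable : exists N, forall i, lead i `<=` lead N.
Proof.
have [s [sL smin]] := (noetherianP (@subring_setT A)).1 nA _ leads_ideal.
have [N sN] : exists N, forall x, x \in s -> lead N x.
  elim: s sL {smin} => [|x s IHs] sL; first by exists 0%N.
  have [|N sN] := IHs; first by move=> y ys; apply: sL; rewrite inE ys orbT.
  have [|i xi] := sL x; first by rewrite inE eqxx.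
  exists (maxn i N) => y; rewrite inE => /orP[/eqP->|/sN].
    exact: (lead_mono (leq_maxl _ _)).
  exact: (lead_mono (leq_maxr _ _)).
by exists N => i c ci; apply: (smin _ (lead_ideal N)) => //; exists i.
Qed.

(** By induction on [i]: polynomials whose coefficients at [i] generate [lead i] are added to the
    list, and subtracting a combination of them lowers the degree. *)
Let low_degree_fgen i : exists s : seq {poly A}, (forall x, x \in s -> J x) /\
  forall K, is_ideal setT K -> (forall x, x \in s -> K x) ->
  forall p, J p -> (size p <= i)%N -> K p.
Proof.
elim: i => [|i [s [sJ smin]]].
  exists [::]; split=> // K hK _ p _; rewrite leqn0 size_poly_eq0 => /eqP ->.
  exact: ideal0 hK.
have [t [tL tmin]] := (noetherianP (@subring_setT A)).1 nA _ (lead_ideal i).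
have [s' [s'J s't]] : exists s' : seq {poly A}, (forall x, x \in s' ->
    J x /\ (size x <= i.+1)%N) /\ forall c, c \in t -> exists2 p, p \in s' & p`_i = c.
  elim: t tL {tmin} => [|c t IHt] tL; first by exists [::].
  have [|s' [s'J s't]] := IHt; first by move=> y yt; apply: tL; rewrite inE yt orbT.
  have [|p [Jp sp pc]] := tL c; first by rewrite inE eqxx.
  exists (p :: s'); split=> [x|d]; rewrite inE => /orP[/eqP->//|].
  - exact: s'J.
  - by exists p; rewrite ?inE ?eqxx.
  - by move=> /s't[q qs qd]; exists q; rewrite ?inE ?qs ?orbT.
exists (s ++ s'); split=> [x|K hK sK p Jp sp].
  by rewrite mem_cat => /orP[/sJ//|/s'J[]].
(* The top coefficients attained inside both [J] and [K] form an ideal that contains [t], hence all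
   of [lead i]. *)
pose L := [set c | exists q, [/\ J q, K q, (size q <= i.+1)%N & q`_i = c]].
have hL : is_ideal setT L.
  split=> //.
  - by exists 0; rewrite size_poly0 coef0; split=> //; [apply: ideal0 hJ|apply: ideal0 hK].
  - move=> _ _ [q [Jq Kq sq <-]] [q' [Jq' Kq' sq' <-]]; exists (q + q').
    rewrite coefD; split=> //; [exact: (idealD hJ)|exact: (idealD hK)|].
    by rewrite (leq_trans (size_polyD _ _)) // geq_max sq.
  - move=> b _ _ [q [Jq Kq sq <-]]; exists (b%:P * q); rewrite coefCM.
    split=> //; [exact: (idealMl hJ)|exact: (idealMl hK)|].
    by rewrite mul_polyC (leq_trans (size_scale_leq _ _)).
have [q [Jq Kq sq qp]] : L p`_i.
  apply: (tmin _ hL); last by exists p.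
  move=> c /s't[q qs' qc]; have [Jq sq] := s'J q qs'; exists q; split=> //.
  by apply: sK; rewrite mem_cat qs' orbT.
rewrite -[p](subrK q); apply: (idealD hK) => //.
apply: (smin _ hK) => [x xs||]; first by apply: sK; rewrite mem_cat xs.
  exact: (idealB hJ).
apply/leq_sizeP => j; rewrite leq_eqVlt coefB => /predU1P[<-|ij].
  by rewrite qp subrr.
by rewrite !nth_default ?subrr // (leq_trans _ ij).
Qed.

Lemma poly_ideal_fgen : fgen setT J.
Proof.
have [N leadN] := leads_stable; have [s [sJ smin]] := low_degree_fgen N.+1.
exists s; split=> // K hK sK p; have [m] := ubnP (size p).
elim: m p => // m IHm p sp Jp; have [spN|spN] := leqP (size p) N.+1.
  exact: (smin _ hK).
have [d sd] : exists d, size p = d.+1 by case: (size p) spN => // d; exists d.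
(* Beyond degree [N] the leading coefficient of [p] also occurs in degree [N]; a shift by a power of
   the variable cancels it. *)
rewrite sd in sp spN; have [|q [Jq sq qp]] := leadN d p`_d.
  by exists p; rewrite sd.
have KX : K (q * 'X^(d - N)) by apply: (idealMr hK) => //; apply: (smin _ hK).
have -> : p = p - q * 'X^(d - N) + q * 'X^(d - N) by rewrite subrK.
apply: (idealD hK) => //.
apply: IHm; last by apply: (idealB hJ) => //; apply: (idealMr hJ).
rewrite (leq_ltn_trans _ (sp : d < m)%N) //.
apply/leq_sizeP => j; rewrite leq_eqVlt coefB coefMXn => /predU1P[<-|ij].
  by rewrite ltnNge leq_subr subKn ?qp ?subrr //; lia.
rewrite ltnNge (leq_trans (leq_subr _ _) (ltnW ij)) /= !nth_default ?subrr ?sd //.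
by rewrite (leq_trans sq) //; lia.
Qed.

End HilbertBasis.

Lemma poly_noetherian (A : comNzRingType) :
  noetherian [set: A] -> noetherian [set: {poly A}].
Proof. by move=> nA; apply/noetherianP => // J; apply: poly_ideal_fgen. Qed.

(** * Algebraic independence *)

Section AlgebraicValues.
Variables (k : fieldType) (T : comNzRingType) (iota : {rmorphism k -> T}).
Implicit Types (B P : set T) (gs : seq T).

(** The k-subalgebra generated by [gs], built one generator at a time so that its elements come as
    polynomials in the first generator. *)
Fixpoint algval gs : set T :=
  if gs is g :: gs' then
    [set x | exists p : {poly T}, (forall i, algval gs' p`_i) /\ x = p.[g]]
  else range iota.

(* The values at gs of nonzero polynomials over k: viewed as a polynomial in
   the first variable, such a polynomial has a lowest nonzero coefficient. *)
Fixpoint nzval gs : set T :=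
  if gs is g :: gs' then
    [set x | exists a y x', [/\ nzval gs' y, algval gs x' & x = g ^+ a * (y + g * x')]]
  else [set x | exists2 c, c != 0 & x = iota c].

(** For a prime ideal [P], this is algebraic independence over k of the classes of [gs] modulo
    [P]. *)
Definition alg_indep P gs : Prop := forall y, nzval gs y -> ~ P y.

Lemma algval_subring gs : subring_set (algval gs).
Proof.
elim: gs => [|g gs IHgs] /=.
  split; first by exists 1; rewrite ?rmorph1.
    by move=> _ _ [c _ <-] [d _ <-]; exists (c - d); rewrite ?rmorphB.
  by move=> _ _ [c _ <-] [d _ <-]; exists (c * d); rewrite ?rmorphM.
split.
- exists 1; rewrite hornerC; split=> // i; rewrite coef1.
  by case: eqP => _; [case: IHgs|apply: subring_set0].
- move=> _ _ [p [hp ->]] [q [hq ->]]; exists (p - q).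
  by rewrite hornerD hornerN; split=> // i; rewrite coefB; case: IHgs => _ + _; apply.
- move=> _ _ [p [hp ->]] [q [hq ->]]; exists (p * q).
  rewrite hornerM; split=> // i; rewrite coefM; apply: (subring_set_sum IHgs) => j.
  by case: IHgs => _ _; apply.
Qed.

Lemma algval_cons g gs : algval gs `<=` algval (g :: gs).
Proof.
move=> x hx; exists x%:P; rewrite hornerC; split=> // i; rewrite coefC.
by case: ifP => // _; apply: subring_set0 (algval_subring gs).
Qed.

Lemma algval_head g gs : algval (g :: gs) g.
Proof.
exists 'X; rewrite hornerX; split=> // i; rewrite coefX.
case: (i == 1%N); last exact: subring_set0 (algval_subring gs).
by case: (algval_subring gs).
Qed.

Lemma algval_sub B gs : subring_set B -> (forall c, B (iota c)) ->
  (forall g, g \in gs -> B g) -> algval gs `<=` B.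
Proof.
move=> hB iB; elim: gs => [|g gs IHgs] gsB x /=; first by case=> c _ <-.
case=> p [hp ->]; rewrite horner_coef; apply: (subring_set_sum hB) => i.
case: (hB) => _ _; apply; last by apply: (subring_setX hB); apply: gsB; rewrite inE eqxx.
by apply: IHgs => // h hgs; apply: gsB; rewrite inE hgs orbT.
Qed.

Lemma nzval_algval gs : nzval gs `<=` algval gs.
Proof.
elim: gs => [|g gs IHgs] x; first by case=> c _ ->; exists c.
case=> a [y [x' [/IHgs/(algval_cons g) hy hx' ->]]].
have hgs := algval_subring (g :: gs); have hg := algval_head g gs.
case: (hgs) => _ _ M; apply: (M); first exact: subring_setX.
by apply: subring_setD => //; apply: M.
Qed.

Section Chain.
Variables (B : set T) (hB : subring_set B) (iB : forall c, B (iota c)).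

(** If [f ^+ a * (y + f * x')] is in [P], then so is [y + f * x'] because [f] is not. As [f] is in
    [P'], it follows that [y] is in [P'], against the independence of [gs] modulo [P']. *)
Lemma alg_indep_cons P P' f gs :
  is_prime_ideal B P -> is_ideal B P' -> P `<=` P' -> P' f -> ~ P f ->
  (forall g, g \in gs -> B g) -> alg_indep P' gs -> alg_indep P (f :: gs).
Proof.
move=> pP iP' PP' P'f Pf gsB indP' _ [a [y [x' [hy hx' ->]]]].
have Bf := ideal_sub iP' P'f.
have Bx' : B x'.
  by apply: algval_sub hx' => // g; rewrite inE => /predU1P[->//|/gsB].
have By : B y by apply: algval_sub (nzval_algval hy).
have Bfx : B (f * x') by case: hB => _ _; apply.
case: (pP) => iP P1 PM /PM[|||hP].
- exact: subring_setX.
- exact: subring_setD.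
- by move/(prime_idealX hB pP Bf).
- apply: (indP' y hy); rewrite -[y](addrK (f * x')).
  by apply: (idealB iP' hB); [apply: PP'|apply: (idealMr iP')].
Qed.

(** Each strict inclusion of the chain contributes one independent element, picked in the larger
    prime and outside the smaller one. *)
Lemma prime_chain_alg_indep m (P : nat -> set T) gs :
  (forall i, (i <= m)%N -> is_prime_ideal B (P i)) ->
  (forall i, (i < m)%N -> P i `<` P i.+1) ->
  (forall g, g \in gs -> B g) -> alg_indep (P m) gs ->
  exists fs, [/\ size fs = m, forall f, f \in fs -> B f & alg_indep (P 0) (fs ++ gs)].
Proof.
move=> pP ltP gsB; elim: m P pP ltP => [|m IHm] P pP ltP indP; first by exists [::].
have [||//|fs [sfs fsB ind]] := IHm (P \o S).
- by move=> i im; apply: pP.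
- by move=> i im; apply: ltP.
have [P01 /existsNP[f /not_implyP[P1f P0f]]] := ltP 0 isT.
have [p0 p1] := (pP 0 isT, pP 1 isT); have i1 := prime_ideal_ideal p1.
exists (f :: fs); split=> /=; first by rewrite sfs.
  by move=> g; rewrite inE => /predU1P[->|/fsB//]; apply: ideal_sub P1f.
apply: (alg_indep_cons p0 i1) => // g; rewrite mem_cat => /orP[/fsB//|/gsB//].
Qed.

End Chain.
End AlgebraicValues.

Section AlgebraicValuesMorphism.
Variables (k : fieldType) (T T' : comNzRingType).
Variables (iota : {rmorphism k -> T}) (iota' : {rmorphism k -> T'}).
Variables (phi : {rmorphism T -> T'}) (phi_iota : forall c, phi (iota c) = iota' c).

Lemma algval_map gs x : algval iota gs x -> algval iota' (map phi gs) (phi x).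
Proof.
elim: gs x => [|g gs IHgs] x /=; first by case=> c _ <-; exists c.
case=> p [hp ->]; exists (map_poly phi p); rewrite horner_map; split=> // i.
by rewrite coef_map; apply: IHgs.
Qed.

Lemma nzval_map gs x : nzval iota gs x -> nzval iota' (map phi gs) (phi x).
Proof.
elim: gs x => [|g gs IHgs] x; first by case=> c c0 ->; exists c.
case=> a [y [x' [hy hx' ->]]]; exists a, (phi y), (phi x'); split.
- exact: IHgs.
- exact: algval_map hx'.
- by rewrite rmorphM rmorphXn rmorphD rmorphM.
Qed.

Lemma algval_map_ex gs y : algval iota' (map phi gs) y ->
  exists x, algval iota gs x /\ y = phi x.
Proof.
elim: gs y => [|g gs IHgs] y /=.
  by case=> c _ <-; exists (iota c); split=> //; exists c.
case=> p [hp ->]; have [q hq] := choice (fun i => IHgs _ (hp i)).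
exists (\sum_(i < size p) q i * g ^+ i); split; last first.
  rewrite horner_coef rmorph_sum; apply: eq_bigr => i _.
  by rewrite rmorphM rmorphXn (hq i).2.
exists (\poly_(i < size p) q i); rewrite horner_poly; split=> // i.
rewrite coef_poly; case: ifP => _; first by case: (hq i).
exact: subring_set0 (algval_subring _ _).
Qed.

Lemma nzval_map_ex gs y : nzval iota' (map phi gs) y ->
  exists x, nzval iota gs x /\ y = phi x.
Proof.
elim: gs y => [|g gs IHgs] y.
  by case=> c c0 ->; exists (iota c); rewrite phi_iota; split=> //; exists c.
case=> a [_ [_ [/IHgs[y0 [hy0 ->]] /(@algval_map_ex (g :: gs))[x0 [hx0 ->]] ->]]].
exists (g ^+ a * (y0 + g * x0)); split; first by exists a, y0, x0.
by rewrite rmorphM rmorphXn rmorphD rmorphM.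
Qed.

End AlgebraicValuesMorphism.

Lemma msizeM_leS (k : fieldType) n (p q : {mpoly k[n]}) d e :
  (msize p <= d.+1)%N -> (msize q <= e.+1)%N -> (msize (p * q) <= (d + e).+1)%N.
Proof.
have [->|p0] := eqVneq p 0; first by rewrite mul0r mmeasure0.
have [->|q0] := eqVneq q 0; first by rewrite mulr0 mmeasure0.
move=> hp hq; rewrite msizeM //; apply: (@leq_trans (d.+1 + e.+1).-1).
  by rewrite -!subn1 leq_sub2r // leq_add.
by rewrite addnS addSn.
Qed.

Lemma msizeX_leS (k : fieldType) n (p : {mpoly k[n]}) d i :
  (msize p <= d.+1)%N -> (msize (p ^+ i) <= (i * d).+1)%N.
Proof.
move=> hp; elim: i => [|i IHi]; first by rewrite expr0 msize1.
by rewrite exprS mulSn; apply: msizeM_leS.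
Qed.

Lemma card_bmultinom n d : (#|{: 'X_{1..n < d.+1}}| <= d.+1 ^ n)%N.
Proof.
pose f (m : 'X_{1..n < d.+1}) : {ffun 'I_n -> 'I_d.+1} := [ffun i => inord (m i)].
have f_inj : injective f.
  move=> m m' /ffunP fmm'; apply/val_inj/mnmP => i.
  have bound (x : 'X_{1..n < d.+1}) : (x i < d.+1)%N.
    by apply: leq_ltn_trans (bmdeg x); rewrite mdegE (bigD1 i) //= leq_addr.
  by have := congr1 val (fmm' i); rewrite !ffunE /= !inordK.
by have := leq_card f f_inj; rewrite card_ffun !card_ord.
Qed.

(** * Bound on the number of algebraically independent fractions of polynomials *)

Section TranscendenceDegree.
Variables (k : fieldType) (n : nat) (T : idomainType).
Variables (j : {rmorphism {mpoly k[n]} -> T}) (j_inj : injective j).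
Variables (iota : {rmorphism k -> T}) (iotaE : forall c, iota c = j c%:MP).
Implicit Types (gs : seq T).

Definition quotient_value : set T := [set g | exists a b, b != 0 /\ g * j b = j a].

Fixpoint exponents t gs : finType :=
  if gs is _ :: gs' then ('I_t.+1 * exponents t gs')%type else unit.

Fixpoint monomial t gs : exponents t gs -> T :=
  match gs with
  | [::] => fun=> 1
  | g :: gs' => fun a : 'I_t.+1 * exponents t gs' => g ^+ a.1 * monomial a.2
  end.

Lemma card_exponents t gs : #|exponents t gs| = (t.+1 ^ size gs)%N.
Proof.
elim: gs => [|g gs IHgs]; first by rewrite card_unit.
by rewrite /= card_prod IHgs card_ord expnS.
Qed.

Let comb t gs (c : exponents t gs -> k) : T := \sum_a iota (c a) * monomial a.

Let comb_cons t g gs (c : exponents t (g :: gs) -> k) :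
  comb c = \sum_(0 <= i < t.+1) g ^+ i * comb (fun a => c (inord i, a)).
Proof.
rewrite big_mkord /comb.
pose f i b := iota (c (i, b)) * monomial ((i, b) : exponents t (g :: gs)).
rewrite (eq_bigr (fun a => f a.1 a.2)); last by case.
rewrite -(pair_bigA _ f) /=.
apply: eq_bigr => i _; rewrite mulr_sumr; apply: eq_bigr => a _.
by rewrite inord_val mulrCA.
Qed.

Let comb_algval t gs (c : exponents t gs -> k) : algval iota gs (comb c).
Proof.
elim: gs c => [|g gs IHgs] c.
  rewrite /comb; apply: (subring_set_sum (algval_subring iota [::])) => a.
  by exists (c a); rewrite ?mulr1.
have hgs := algval_subring iota (g :: gs); case: (hgs) => _ _ hM.
rewrite comb_cons; apply: (subring_set_sum hgs) => i; apply: hM.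
  exact/(subring_setX hgs)/algval_head.
exact/algval_cons/IHgs.
Qed.

(** The smallest power of [g] with a nonzero coefficient provides the exponent [a] in [nzval]. *)
Let comb_nzval t gs (c : exponents t gs -> k) :
  (exists a, c a != 0) -> nzval iota gs (comb c).
Proof.
elim: gs c => [|g gs IHgs] c /= [a ca].
  exists (c a) => //.
  by rewrite /comb (bigD1 a) //= big1 ?addr0 ?mulr1 // => -[]; case: a {ca}.
pose nz i := [exists a, c (inord i, a) != 0].
have exi : exists i, (i <= t)%N && nz i.
  exists a.1; rewrite -ltnS ltn_ord; apply/existsP; exists a.2.
  by rewrite inord_val; case: a ca.
case: (ex_minnP exi) => i /andP[it nzi] imin.
have zero l : (l < i)%N -> comb (fun a => c (inord l, a)) = 0.
  move=> li; rewrite /comb big1 // => b _.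
  have [->|nzl] := eqVneq (c (inord l, b)) 0; first by rewrite rmorph0 mul0r.
  suff: (i <= l)%N by lia.
  by apply: imin; rewrite (leq_trans (ltnW li) it); apply/existsP; exists b.
have hgs := algval_subring iota (g :: gs); case: (hgs) => _ _ hM.
exists i, (comb (fun a => c (inord i, a))),
  (\sum_(i.+1 <= l < t.+1) g ^+ (l - i.+1) * comb (fun a => c (inord l, a))); split.
- by apply: IHgs; apply/existsP.
- apply: (subring_set_sum hgs) => l; apply: hM.
    exact/(subring_setX hgs)/algval_head.
  exact/algval_cons/comb_algval.
rewrite comb_cons (big_cat_nat (n := i)) //=; last by lia.
rewrite big1_seq ?add0r; last first.
  by move=> l /andP[_]; rewrite mem_index_iota => /andP[_ li]; rewrite zero ?mulr0.
rewrite big_ltn // mulrDr; congr (_ + _); rewrite mulrA -exprSr mulr_sumr.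
rewrite [LHS]big_seq [RHS]big_seq; apply: eq_bigr => l.
by rewrite mem_index_iota => /andP[il _]; rewrite mulrA -exprD subnKC.
Qed.

(** A common denominator [H] of [gs] clears all monomials with exponents at most [t] once raised to
    the power [t], and the degrees of the numerators grow linearly in [t]. *)
Let monomial_numerator gs : (forall g, g \in gs -> quotient_value g) ->
  exists H D, H != 0 /\ forall t (a : exponents t gs), exists Q,
    monomial a * j (H ^+ t) = j Q /\ (msize Q <= (t * D).+1)%N.
Proof.
elim: gs => [|g gs IHgs] gsq.
  exists 1, 0%N; rewrite oner_neq0; split=> // t a; exists 1.
  by rewrite /= expr1n !rmorph1 mulr1 msize1.
have [|H [D [H0 HQ]]] := IHgs; first by move=> h hgs; apply: gsq; rewrite inE hgs orbT.
have [|p [q [q0 gqp]]] := gsq g; first by rewrite inE eqxx.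
exists (q * H), (maxn (msize p) (msize q) + D)%N; rewrite mulf_neq0 //; split=> // t a.
have [Q [aQ sQ]] := HQ t a.2; have at' : (a.1 <= t)%N by rewrite -ltnS ltn_ord.
exists (p ^+ a.1 * q ^+ (t - a.1) * Q); split.
  have qt : j q ^+ t = j q ^+ a.1 * j q ^+ (t - a.1) by rewrite -exprD subnKC.
  rewrite /= !rmorphM -aQ exprMn rmorphM !rmorphXn -gqp exprMn qt.
  by ring.
rewrite mulnDr; apply: msizeM_leS => //.
have -> (m : nat) : (t * m = a.1 * m + (t - a.1) * m)%N by rewrite -mulnDl subnKC.
by apply: msizeM_leS; apply/msizeX_leS/leqW; rewrite ?leq_maxl ?leq_maxr.
Qed.

(** A dimension count: with more than [n] elements, the numerators of their monomials outnumber the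
    dimension of the space of polynomials that contains them, so some nontrivial combination
    vanishes. *)
Lemma alg_indep_size gs : (forall g, g \in gs -> quotient_value g) ->
  alg_indep iota [set 0] gs -> (size gs <= n)%N.
Proof.
move=> gsq ind; rewrite leqNgt; apply/negP => ngs.
have [H [D [H0 HQ]]] := monomial_numerator gsq.
(* This choice gives [(t * D).+1 ^ n <= t.+1 ^ n * t < t.+1 ^ n.+1], so the matrix [M] has more rows
   than columns. *)
pose t := (D.+1 ^ n)%N; have {HQ}[Q HQ] := choice (HQ t).
pose M := \matrix_(a < #|exponents t gs|, m < #|{: 'X_{1..n < (t * D).+1}}|)
  (Q (enum_val a))@_(enum_val m : 'X_{1..n < (t * D).+1}).
have few : (#|{: 'X_{1..n < (t * D).+1}}| < #|exponents t gs|)%N.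
  rewrite card_exponents (leq_ltn_trans (card_bmultinom _ _)) //.
  apply: (@leq_trans (t.+1 ^ n.+1)); last by rewrite leq_pexp2l.
  apply: (@leq_ltn_trans ((t.+1 * D.+1) ^ n)%N).
    by case: (n) => // n'; rewrite leq_exp2r //; nia.
  by rewrite expnMn expnS mulnC ltn_mul2r expn_gt0 /= ltnSn.
have : ~~ row_free M.
  by rewrite /row_free neq_ltn (leq_ltn_trans (rank_leq_col M) few).
rewrite -kermx_eq0 => /rowV0Pn[v /sub_kermxP vM v0].
pose c a := v 0 (enum_rank a).
have sumQ : \sum_a (c a)%:MP * Q a = 0.
  apply/mpolyP => m; rewrite mcoeff0 raddf_sum /=.
  have [mt|mt] := ltnP (mdeg m) (t * D).+1; last first.
    rewrite big1 // => a _; rewrite mcoeffCM; apply/eqP; rewrite mulf_eq0 mcoeff_eq0.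
    by apply/orP; right; apply: msize_mdeg_ge; apply: leq_trans mt; case: (HQ a).
  have /rowP/(_ (enum_rank (BMultinom mt))) := vM; rewrite !mxE => vM0.
  rewrite -[RHS]vM0 (reindex (fun i : 'I_#|exponents t gs| => enum_val i)) /=;
    last exact: onW_bij (enum_val_bij _).
  by apply: eq_bigr => i _; rewrite mcoeffCM /c enum_valK mxE enum_rankK.
apply: (ind (comb c)); last first.
  have: comb c * j (H ^+ t) = 0.
    rewrite -(rmorph0 j) -sumQ rmorph_sum mulr_suml; apply: eq_bigr => a _.
    by rewrite -mulrA (HQ a).1 rmorphM iotaE.
  move/eqP; rewrite mulf_eq0 => /orP[/eqP//|]; rewrite rmorphXn expf_eq0 => /andP[_].
  by rewrite -(rmorph0 j) (inj_eq j_inj) (negPf H0).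
apply: comb_nzval; have /rV0Pn[i vi] := v0.
by exists (enum_val i); rewrite /c enum_valK.
Qed.

End TranscendenceDegree.

(** * Regularity of polynomial rings *)

(** The endomorphism [rho] kills ['X_i] and fixes the other variables; applied to
    [y + 'X_i * x' = 0] it gives [y = 0], which the induction hypothesis excludes. *)
Lemma mpolyX_alg_indep (k : fieldType) n (s : seq 'I_n) : uniq s ->
  alg_indep (@mpolyC n k) [set 0] [seq 'X_i | i <- s].
Proof.
elim: s => [_ _ [c c0 ->] /eqP|i s IHs /andP[is_ us] _ [a [y [x' [hy _ ->]]]] /eqP].
  by rewrite mpolyC_eq0 (negPf c0).
have X0 : 'X_i != 0 :> {mpoly k[n]} by rewrite -(mmeasure_poly_eq0 mdeg) mmeasureX.
rewrite mulf_eq0 expf_eq0 (negPf X0) andbF /= => /eqP yx.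
pose h (l : 'I_n) : {mpoly k[n]} := if l == i then 0 else 'X_l.
pose rho : {rmorphism {mpoly k[n]} -> {mpoly k[n]}} := mmap (@mpolyC n k) h.
have rhoX l : rho 'X_l = h l by rewrite /= mmapX mmap1U.
have fixS : subring_set [set f | rho f = f].
  split=> [|x z /= xE zE|x z /= xE zE]; first exact: rmorph1.
    by rewrite -[RHS](congr2 (fun u v => u - v) xE zE); exact: rmorphB.
  by rewrite -[RHS](congr2 (fun u v => u * v) xE zE); exact: rmorphM.
have rhoy : rho y = y.
  apply: (algval_sub fixS) (nzval_algval hy) => [c|_ /mapP[l ls ->]] /=.
    exact: mmapC.
  by rewrite rhoX /h; case: eqP ls is_ => // -> ->.
apply: (IHs us y hy); have := congr1 rho yx.
by rewrite rmorphD rmorphM rmorph0 rhoX /h eqxx mul0r addr0 rhoy.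
Qed.

Section RegularRings.
Variables (k : fieldType).

Definition prime_chain (T : comNzRingType) (B : set T) d (P : nat -> set T) : Prop :=
  (forall i, (i <= d)%N -> is_prime_ideal B (P i)) /\
  (forall i, (i < d)%N -> P i `<` P i.+1).

(* Up to multiplication by elements outside P, the ideal P is generated by gs;
   that is, gs generates the maximal ideal of the localization at P. *)
Definition local_generators (A : comNzRingType) (P : set A) (gs : seq A) : Prop :=
  (forall x, x \in gs -> P x) /\
  forall x, P x -> exists s, ~ P s /\
    forall K, is_ideal setT K -> (forall g, g \in gs -> K g) -> K (s * x).

(* The integers d and e are the height of P and the dimension of the quotient
   by P. *)
Definition regular_at (A : comNzRingType) (iota : {rmorphism k -> A}) N (P : set A) :=
  exists d e (C : nat -> set A) (gs fs : seq A),
  [/\ (d + e)%N = N, prime_chain setT d C /\ C d = P,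
      local_generators P gs /\ size gs = d & alg_indep iota P fs /\ size fs = e].

Definition regular_of_dim (A : comNzRingType) (iota : {rmorphism k -> A}) N :=
  noetherian [set: A] /\
  forall P : set A, is_prime_ideal setT P -> regular_at iota N P.

Lemma regular_field (iota : {rmorphism k -> k}) : iota =1 id ->
  regular_of_dim iota 0.
Proof.
move=> iotaE; split; first exact: field_noetherian.
move=> P pP; have [iP P1 _] := pP.
have P0 x : P x -> x = 0.
  move=> Px; apply/eqP/negPn/negP => x0; apply: P1.
  by rewrite -(mulVf x0); apply: (idealMl iP).
exists 0%N, 0%N, (fun=> P), [::], [::]; split=> //; split=> //.
- split=> // x /P0 ->; exists 1; split=> // K hK _.
  by rewrite mulr0; apply: ideal0 hK.
- by move=> _ [c c0 ->]; rewrite iotaE => /P0 /eqP; rewrite (negPf c0).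
Qed.

End RegularRings.

Section PolynomialExtension.
Variable A : comNzRingType.
Implicit Types P Q : set A.

Definition poly_ext P : set {poly A} := [set f | forall i, P f`_i].

Lemma poly_extC P a : is_ideal setT P -> poly_ext P a%:P <-> P a.
Proof.
move=> iP; split=> [/(_ 0%N)|Pa i]; rewrite coefC //.
by case: ifP => _ //; apply: ideal0 iP.
Qed.

Lemma poly_ext_ideal P : is_ideal setT P -> is_ideal setT (poly_ext P).
Proof.
move=> iP; split=> //.
- by move=> i; rewrite coef0; apply: ideal0 iP.
- by move=> x y Px Py i; rewrite coefD; apply: (idealD iP).
- move=> b x _ Px i; rewrite coefM; apply: (ideal_sum iP) => j _.
  exact: (idealMl iP).
Qed.

(** Let [i] and [j] be the lowest degrees where [x] and [y] have coefficients outside [P]. Modulo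
    [P], the coefficient of [x * y] in degree [i + j] is the product of these two. *)
Lemma poly_ext_prime P : is_prime_ideal setT P -> is_prime_ideal setT (poly_ext P).
Proof.
move=> pP; have [iP P1 PM] := pP; have iE := poly_ext_ideal iP.
split=> // [/(_ 0%N)|x y _ _ Pxy]; first by rewrite coef1.
apply: contrapT => /not_orP[] nx ny.
have low f : ~ poly_ext P f -> exists i, ~ P f`_i /\ forall j, (j < i)%N -> P f`_j.
  move=> /existsNP[i Pi]; have ex : exists i, ~~ `[< P f`_i >] by exists i; apply/asboolPn.
  case: (ex_minnP ex) => m /asboolPn Pm mmin; exists m; split=> // j jm.
  by apply: contrapT => /asboolPn /mmin; lia.
have [[i [xi xlt]] [j [yj ylt]]] := (low _ nx, low _ ny).
have : P (x`_i * y`_j); last by case/PM.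
have ij : (i < (i + j).+1)%N by rewrite ltnS leq_addr.
have := Pxy (i + j)%N; rewrite coefM (bigD1 (Ordinal ij)) //= addKn => h.
have rest : P (\sum_(l < (i + j).+1 | l != Ordinal ij) x`_l * y`_(i + j - l)).
  apply: (ideal_sum iP) => l li; have [lti|gti] := ltnP l i.
    by apply: (idealMr iP) => //; apply: xlt.
  apply: (idealMl iP) => //; apply: ylt.
  have : nat_of_ord l != i by apply: contra_neq li => e; apply: val_inj.
  by have := ltn_ord l; lia.
by have := idealB iP (@subring_setT A) h rest; rewrite addrK.
Qed.

Lemma poly_ext_lt P Q : is_ideal setT P -> is_ideal setT Q ->
  P `<` Q -> poly_ext P `<` poly_ext Q.
Proof.
move=> iP iQ [PQ nQP]; split=> [f Pf i|QP]; first exact/PQ/Pf.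
by apply: nQP => a /(poly_extC a iQ)/QP/(poly_extC a iP).
Qed.

Section Step.
Variables (k : fieldType) (iota : {rmorphism k -> A}) (iota' : {rmorphism k -> {poly A}}).
Hypothesis iotaE : forall c, (iota c)%:P = iota' c.
Variables (Q : set {poly A}) (pQ : is_prime_ideal setT Q).

Let P : set A := [set a | Q a%:P].

Let pP : is_prime_ideal setT P.
Proof.
have [iQ Q1 QM] := pQ; split=> //; last by move=> x y _ _; rewrite /P /= rmorphM; apply: QM.
split=> //; first by rewrite /P /= rmorph0; apply: ideal0 iQ.
- by move=> x y; rewrite /P /= rmorphD; apply: (idealD iQ).
- by move=> b x _; rewrite /P /= rmorphM; apply: (idealMl iQ).
Qed.

Let iP := prime_ideal_ideal pP.
Let iQ := prime_ideal_ideal pQ.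

Let contraction_ideal (K : set {poly A}) : is_ideal setT K ->
  is_ideal setT [set a | K a%:P].
Proof.
move=> hK; split=> //=; first by rewrite rmorph0; apply: ideal0 hK.
- by move=> x y; rewrite rmorphD; apply: (idealD hK).
- by move=> b x _; rewrite rmorphM; apply: (idealMl hK).
Qed.

Let nzval_polyC fs y : nzval iota' (map polyC fs) y ->
  exists x, nzval iota fs x /\ y = x%:P.
Proof. exact: (@nzval_map_ex _ _ _ iota iota' polyC iotaE). Qed.

Let poly_ext_sub : poly_ext P `<=` Q.
Proof.
move=> f Pf; rewrite -[f]coefK poly_def; apply: (ideal_sum iQ) => i _.
by rewrite -mul_polyC; apply: (idealMr iQ) => //; apply: Pf.
Qed.

Let ext_chain d (C : nat -> set A) : prime_chain setT d C ->
  prime_chain setT d (poly_ext \o C).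
Proof.
move=> [pC ltC]; split=> i id; first exact/poly_ext_prime/pC.
by apply: poly_ext_lt (ltC i id); apply/prime_ideal_ideal/pC => //; apply: ltnW.
Qed.

(** Each coefficient of [f] needs its own multiplier outside [P]; the product of these finitely many
    elements serves for all of [f]. *)
Let ext_generators gs f : local_generators P gs -> poly_ext P f ->
  exists s, ~ P s /\ forall K, is_ideal setT K ->
    (forall g, g \in gs -> K g%:P) -> K (s%:P * f).
Proof.
move=> [_ genP] Pf; have /choice[s hs] := fun i => genP _ (Pf i).
have [m fE] : exists m, f = \sum_(i < m) f`_i *: 'X^i.
  by exists (size f); rewrite -poly_def coefK.
exists (\prod_(i < m) s i); split.
  by apply: (prime_prod_notin (@subring_setT A) pP) => i; case: (hs i).
move=> K hK gsK; rewrite [X in _ * X]fE mulr_sumr.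
apply: (ideal_sum hK) => i _; rewrite -mul_polyC mulrA -rmorphM.
apply: (idealMr hK) => //; rewrite (bigD1 i) //= mulrAC.
apply: (idealMr (contraction_ideal hK)) => //.
exact: (hs i).2 (contraction_ideal hK) gsK.
Qed.

(** The case [Q = P[X]]: the height is unchanged, while ['X] joins the elements that are independent
    modulo the prime. *)
Let regular_at_ext d e C gs fs : Q `<=` poly_ext P ->
  prime_chain setT d C -> C d = P -> local_generators P gs -> size gs = d ->
  alg_indep iota P fs -> size fs = e -> regular_at iota' (d + e.+1) Q.
Proof.
move=> QP hC Cd genP sgs indP sfs.
have QE : Q = poly_ext P by apply/seteqP; split.
exists d, e.+1, (poly_ext \o C), (map polyC gs), ('X :: map polyC fs).
rewrite /= !size_map sgs sfs; split=> //; split=> //.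
- exact: ext_chain.
- by rewrite /= Cd QE.
- split=> [_ /mapP[g ggs ->]|f Qf]; first exact: genP.1.
  have [s [Ps hs]] := ext_generators genP (QP f Qf).
  exists s%:P; split=> // K hK gsK; apply: hs => // g ggs.
  by apply/gsK/map_f.
- move=> _ [a [y [x' [hy _ ->]]]] Qx.
  have [y0 [hy0 yE]] := nzval_polyC hy.
  apply: (indP y0 hy0); have := QP _ Qx a.
  by rewrite coefXnM ltnn subnn coefD coefXM addr0 yE coefC.
Qed.

(* A polynomial of minimal degree in Q outside P[X] has its leading coefficient
   outside P, so that dividing by it reduces Q to P[X]. *)
Let regular_at_alg d e C gs fs : ~ Q `<=` poly_ext P ->
  prime_chain setT d C -> C d = P -> local_generators P gs -> size gs = d ->
  alg_indep iota P fs -> size fs = e -> regular_at iota' (d.+1 + e) Q.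
Proof.
move=> nQP hC Cd genP sgs indP sfs.
have ex : exists m, `[< exists f, [/\ Q f, ~ poly_ext P f & size f = m] >].
  have /existsNP[f /not_implyP[Qf Pf]] := nQP.
  by exists (size f); apply/asboolP; exists f.
case: (ex_minnP ex) => m /asboolP[f [Qf Pf sf]] mmin.
have small h : Q h -> (size h < m)%N -> poly_ext P h.
  move=> Qh hm; apply: contrapT => Ph.
  have : (m <= size h)%N by apply/mmin/asboolP; exists h.
  by rewrite leqNgt hm.
have [m' mE] : exists m', m = m'.+1.
  case: m sf {mmin small} => [/eqP|m' _]; last by exists m'.
  rewrite size_poly_eq0 => /eqP f0; case: Pf => i; rewrite f0 coef0.
  exact: ideal0 iP.
rewrite {m}mE in sf mmin small.
(* Otherwise removing the leading term gives an element of [Q] of smaller degree, which lies in P[X]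
   by minimality, and then so does [f]. *)
have lead : ~ P f`_m'.
  move=> Pl; have Ql : Q (f`_m' *: 'X^m').
    by rewrite -mul_polyC; apply: (idealMr iQ).
  have Pg : poly_ext P (f - f`_m' *: 'X^m').
    apply: small; first exact: (idealB iQ).
    rewrite ltnS; apply/leq_sizeP => j; rewrite leq_eqVlt coefB coefZ coefXn => /predU1P[<-|mj].
      by rewrite eqxx mulr1 subrr.
    by rewrite gtn_eqF // mulr0 subr0 nth_default // sf.
  apply: Pf => i; have := Pg i; rewrite coefB coefZ coefXn.
  have [->//|_] := eqVneq i m'; by rewrite mulr0 subr0.
exists d.+1, e, (fun i => if (i <= d)%N then poly_ext (C i) else Q),
  (f :: map polyC gs), (map polyC fs).
rewrite /= !size_map sgs sfs ltnn; split=> //; split=> //.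
- have [pC ltC] := ext_chain hC.
  split=> i; first by case: ifP => // id _; apply: pC.
  move=> id; have [->|{}id] : i = d \/ (i < d)%N by lia.
    by rewrite leqnn ltnn Cd; split.
  by rewrite (ltnW id) id; apply: ltC.
- split=> [x|]; first by rewrite inE => /predU1P[->//|/mapP[g ggs ->]]; apply: genP.1.
  (* Pseudo-division by [f]: multiplying by its leading coefficient, which is outside [P], and
     cancelling the top term lowers the degree until [small] applies. *)
  suff red N (g : {poly A}) : (size g < N)%N -> Q g ->
      exists s, ~ P s /\ forall K, is_ideal setT K ->
      (forall h, h \in f :: map polyC gs -> K h) -> K (s%:P * g).
    by move=> x Qx; have [s [Ps hs]] := red _ x (ltnSn _) Qx; exists s%:P.
  elim: N g => // N IHN g; rewrite ltnS => gN Qg; have [gm|mg] := leqP (size g) m'.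
    have [s [Ps hs]] := ext_generators genP (small g Qg gm).
    exists s; split=> // K hK gsK; apply: hs => // h hgs.
    by apply: gsK; rewrite inE map_f ?orbT.
  have [b sg] : exists b, size g = b.+1 by case: (size g) mg => // b; exists b.
  have m'b : (m' <= b)%N by rewrite -ltnS -sg.
  pose h := (g`_b)%:P * 'X^(b - m') * f.
  have hc i : h`_i = if (i < b - m')%N then 0 else g`_b * f`_(i - (b - m')).
    by rewrite /h -mulrA coefCM coefXnM; case: ifP => //; rewrite mulr0.
  have [||s [Ps hs]] := IHN ((f`_m')%:P * g - h).
  - apply: leq_trans gN; rewrite sg ltnS; apply/leq_sizeP => j.
    rewrite leq_eqVlt coefB coefCM hc => /predU1P[<-|bj].
      by rewrite ltnNge leq_subr (subKn m'b) (mulrC g`_b) subrr.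
    rewrite ltnNge (leq_trans (leq_subr _ _) (ltnW bj)) /=.
    rewrite (nth_default _ (_ : (size g <= j)%N)) ?sg // [f`_(j - _)]nth_default.
      by rewrite !mulr0 subrr.
    by rewrite sf; lia.
  - by apply: (idealB iQ) => //; apply: (idealMl iQ).
  exists (s * f`_m'); split; first exact: (prime_notM pP).
  move=> K hK fK; have := hs K hK fK; rewrite mulrBr mulrA -rmorphM => Kg.
  rewrite -[_ * g](subrK (s%:P * h)); apply: (idealD hK) => //.
  by rewrite /h mulrA; apply: (idealMl hK) => //; apply: fK; rewrite inE eqxx.
- move=> y hy Qy; have [y0 [hy0 yE]] := nzval_polyC hy.
  by apply: (indP y0 hy0); move: Qy; rewrite yE.
Qed.

Lemma regular_at_poly N : regular_of_dim iota N -> regular_at iota' N.+1 Q.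
Proof.
move=> [_ /(_ P pP)[d [e [C [gs [fs [<- [hC Cd] [genP sgs] [indP sfs]]]]]]]].
have [QP|nQP] := pselect (Q `<=` poly_ext P).
  by rewrite -addnS; apply: (regular_at_ext QP hC Cd genP sgs indP sfs).
by rewrite -addSn; apply: (regular_at_alg nQP hC Cd genP sgs indP sfs).
Qed.

End Step.
End PolynomialExtension.

Lemma regular_poly (k : fieldType) (A : comNzRingType) (iota : {rmorphism k -> A})
    (iota' : {rmorphism k -> {poly A}}) N :
  (forall c, (iota c)%:P = iota' c) ->
  regular_of_dim iota N -> regular_of_dim iota' N.+1.
Proof.
move=> iotaE rA; split; first exact: poly_noetherian rA.1.
by move=> Q pQ; apply: regular_at_poly rA.
Qed.

(** [A] is an iterated ring of polynomials in one variable, so that [regular_poly] applies at each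
    stage. Its variables go to [zs] under [phi] and to [xs] under [psi]; independence of [xs] will
    show that [psi] kills no nonzero element. *)
Lemma regular_algebra (k : fieldType) n (T : comNzRingType) (iotaT : {rmorphism k -> T})
    (zs : seq T) (xs : seq {mpoly k[n]}) :
  size zs = size xs ->
  exists (A : comNzRingType) (iota : {rmorphism k -> A})
    (phi : {rmorphism A -> T}) (psi : {rmorphism A -> {mpoly k[n]}}),
  [/\ (forall c, phi (iota c) = iotaT c) /\ (forall c, psi (iota c) = c%:MP),
      (forall a, algval iotaT zs (phi a)) /\ (forall z, z \in zs -> exists a, phi a = z),
      regular_of_dim iota (size zs)
    & (forall a, algval (@mpolyC n k) xs (psi a)) /\
      forall a, a != 0 -> nzval (@mpolyC n k) xs (psi a)].
Proof.
elim: zs xs => [|z zs IHzs] [|x xs] //= => [_|[szx]].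
  exists k, idfun, iotaT, (@mpolyC n k); split=> //.
  - by split=> // a; exists a.
  - exact: regular_field.
  - by split=> [a|a a0]; exists a.
have [A [iota [phi [psi [[phiE psiE] [phiA zsE] rA [psiA psiN]]]]]] := IHzs xs szx.
have cz : commr_rmorph phi z by move=> a; apply: mulrC.
have cx : commr_rmorph psi x by move=> a; apply: mulrC.
exists {poly A}, (polyC \o iota), (horner_morph cz), (horner_morph cx); split.
- by split=> c; rewrite /= ?phiE -?phiE -?psiE; exact: horner_morphC.
- split=> [p|y]; first by exists (map_poly phi p); split=> // i; rewrite coef_map; apply: phiA.
  rewrite inE => /predU1P[->|/zsE[a <-]].
    by exists 'X; exact: horner_morphX.
  by exists a%:P; exact: horner_morphC.
- exact: (regular_poly (iota := iota)).
have psiP p : algval (@mpolyC n k) (x :: xs) (horner_morph cx p).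
  by exists (map_poly psi p); split=> // i; rewrite coef_map; apply: psiA.
have psiD p c : horner_morph cx (p * 'X + c%:P) = horner_morph cx p * x + psi c.
  by rewrite /horner_morph rmorphD rmorphM /= map_polyX map_polyC hornerMXaddC.
split=> //; elim/poly_ind => [|p c IHp]; first by rewrite eqxx.
(* A zero constant coefficient raises the exponent of [x] in [nzval] by one; a nonzero one is itself
   the lowest coefficient. *)
have [->|c0 _] := eqVneq c 0.
  rewrite addr0 => pX0; have /IHp[a [y [x' [hy hx' pE]]]] : p != 0.
    by apply: contra_neq pX0 => ->; rewrite mul0r.
  exists a.+1, y, x'; split=> //.
  have := psiD p 0; rewrite !rmorph0 !addr0 => psiX.
  by rewrite -[LHS]/(horner_morph cx (p * 'X)) psiX (pE : horner_morph cx p = _) exprSr mulrAC.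
exists 0%N, (psi c), (horner_morph cx p); split; [exact: psiN|exact: psiP|].
by rewrite -[LHS]/(horner_morph cx (p * 'X + c%:P)) psiD mul1r addrC mulrC.
Qed.

(* Otherwise a nonzero element of the kernel, together with preimages of the
   variables, would be n + 1 algebraically independent elements. *)
Lemma regular_algebra_injective (k : fieldType) n (T : idomainType)
    (j : {rmorphism {mpoly k[n]} -> T}) (A : comNzRingType)
    (iota : {rmorphism k -> A}) (phi : {rmorphism A -> T})
    (psi : {rmorphism A -> {mpoly k[n]}}) :
  injective j -> (forall c, phi (iota c) = j c%:MP) ->
  (forall c, psi (iota c) = c%:MP) -> (forall a, a != 0 -> psi a != 0) ->
  (forall i, exists a, phi a = j 'X_i) -> injective phi.
Proof.
move=> j_inj phiE psiE psiN /choice[g gE].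
suff ker0 a : phi a = 0 -> a = 0.
  by move=> a b ab; apply/eqP; rewrite -subr_eq0; apply/eqP/ker0; rewrite rmorphB ab subrr.
move=> a0; apply/eqP/negPn/negP => nza.
(* [A] is a domain because [psi] maps nonzero elements to nonzero elements of a domain. *)
have p0 : is_prime_ideal setT [set (0 : A)].
  split; [exact: is_ideal_zero|by apply/eqP; rewrite oner_neq0|].
  move=> x y _ _ /= /(congr1 psi) /eqP; rewrite rmorphM rmorph0 mulf_eq0.
  by case/orP => h; [left|right]; apply/eqP; apply: contraLR h; apply: psiN.
have pK : is_ideal setT [set b | phi b = 0].
  split=> //=; first exact: rmorph0.
    by move=> x y x0 y0; rewrite rmorphD x0 y0 addr0.
  by move=> b x _ x0; rewrite rmorphM x0 mulr0.
pose xs := [seq g i | i <- enum 'I_n].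
have indK : alg_indep iota [set b | phi b = 0] xs.
  move=> y hy /= y0; have jE c : j c%:MP = (phi \o iota) c by rewrite /= phiE.
  have := nzval_map (iota' := phi \o iota) (fun=> erefl) hy.
  have -> : map phi xs = map j [seq 'X_i | i <- enum 'I_n].
    by rewrite -!map_comp; apply: eq_map => i /=; rewrite gE.
  case/(nzval_map_ex jE) => w [hw]; rewrite y0 -(rmorph0 j) => /j_inj w0.
  by apply: (mpolyX_alg_indep (enum_uniq 'I_n)) hw _; rewrite -w0.
have ind0 : alg_indep iota [set 0] (a :: xs).
  apply: (alg_indep_cons (@subring_setT A) _ p0 pK) indK => // [b ->|/eqP].
    exact: rmorph0.
  by rewrite (negPf nza).
suff : (size (map psi (a :: xs)) <= n)%N.
  by rewrite size_map /= size_map size_enum_ord ltnn.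
apply: (@alg_indep_size _ _ _ idfun _ (@mpolyC n k)) => // [x _|y hy y0].
  by exists x, 1; rewrite oner_neq0 mulr1.
have [b [hb yE]] := nzval_map_ex psiE hy.
have b0 : b != 0 by apply/eqP => b0; apply: (ind0 b hb).
by have := psiN b b0; rewrite -yE y0 eqxx.
Qed.

(** * Localizations of a regular algebra inside a field *)

Section RegularLocalRing.
Variables (k : fieldType) (n : nat) (F : fieldType).
Variables (j : {rmorphism {mpoly k[n]} -> F}) (j_inj : injective j).
Variables (B M : set F) (hB : subring_set B) (iM : is_ideal B M) (M1 : ~ M 1).
Hypothesis unitB : forall b, B b -> ~ M b -> B b^-1.

Let notM_neq0 b : ~ M b -> b != 0.
Proof. by move=> nMb; apply/eqP => b0; apply: nMb; rewrite b0; apply: ideal0 iM. Qed.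

Let ideal_unit J b : is_ideal B J -> J b -> ~ M b -> J 1.
Proof.
move=> iJ Jb Mb; rewrite -(mulVf (notM_neq0 Mb)); apply: (idealMl iJ) => //.
exact/unitB/Mb/(ideal_sub iJ).
Qed.

Lemma units_local_ring : is_local_ring B M.
Proof.
split.
  split=> // J iJ MJ; have [JM|/existsNP[x /not_implyP[Jx Mx]]] := pselect (J `<=` M).
    by right; apply/seteqP; split.
  by left; apply: ideal_unit Mx.
move=> M' [iM' M'1 maxM']; have M'M : M' `<=` M.
  by move=> x M'x; apply: contrapT => Mx; apply/M'1/(ideal_unit iM' M'x).
by case: (maxM' M iM M'M).
Qed.

Lemma units_local_prime : is_prime_ideal B M.
Proof.
split=> // x y Bx By Mxy; apply: contrapT => /not_orP[Mx My]; apply: Mx.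
rewrite -[x](mulfK (notM_neq0 My)); apply: (idealMr iM) => //; exact: unitB.
Qed.

Hypothesis Bj : forall b, B b -> quotient_value j b.
Variables (A : comNzRingType) (iota : {rmorphism k -> A}) (phi : {rmorphism A -> F}).
Hypotheses (phi_inj : injective phi) (phi_iota : forall c, phi (iota c) = j c%:MP).
Hypothesis phiB : forall a, B (phi a).
Hypothesis Bphi : forall b, B b -> exists a s, ~ M (phi s) /\ b = phi a / phi s.
Hypothesis rA : regular_of_dim iota n.

Let pM := units_local_prime.
Let phi_iotaC : {rmorphism k -> F} := phi \o iota.

Let pre_ideal K : is_ideal B K -> is_ideal setT [set a | K (phi a)].
Proof.
move=> hK; split=> //=; first by rewrite rmorph0; apply: ideal0 hK.
- by move=> x y; rewrite rmorphD; apply: (idealD hK).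
- by move=> b x _; rewrite rmorphM; apply: (idealMl hK).
Qed.

Let pre_prime : is_prime_ideal setT [set a | M (phi a)].
Proof.
split=> /=; [exact: pre_ideal|by rewrite rmorph1|].
by move=> x y _ _; rewrite rmorphM; case: pM => _ _; apply.
Qed.

(** Each element of [B] is a unit times its numerator, so inclusions between ideals can be checked
    on the image of [phi]. *)
Let ideal_from_numerators K J : is_ideal B K -> is_ideal B J ->
  (forall a, J (phi a) -> K (phi a)) -> J `<=` K.
Proof.
move=> hK hJ JK b Jb; have Bb := ideal_sub hJ Jb.
have [a [s [Ms bE]]] := Bphi Bb; have s0 := notM_neq0 Ms.
rewrite bE; apply: (idealMr hK); first exact: unitB.
by apply: JK; rewrite -[phi a](divfK s0) -bE; apply: (idealMr hJ).
Qed.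

Let local_noetherian : noetherian B.
Proof.
apply/noetherianP => // J hJ.
have [s [sJ smin]] := (noetherianP (@subring_setT A)).1 rA.1 _ (pre_ideal hJ).
exists (map phi s); split=> [_ /mapP[a /sJ Ja ->]//|K hK sK].
apply: (ideal_from_numerators hK hJ) => a Ja.
apply: (smin _ (pre_ideal hK)) => // x xs.
by apply/sK/map_f.
Qed.

Let ext (C : set A) : set F :=
  [set b | exists a s, [/\ C a, ~ M (phi s) & b = phi a / phi s]].

Let phi_neq0 s : ~ M (phi s) -> phi s != 0. Proof. exact: notM_neq0. Qed.

Let notM_mul s t : ~ M (phi s) -> ~ M (phi t) -> ~ M (phi (s * t)).
Proof. by rewrite rmorphM; apply: (prime_notM pM). Qed.

Let ext_numerator C a : is_prime_ideal setT C -> C `<=` [set a | M (phi a)] ->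
  ext C (phi a) -> C a.
Proof.
move=> [iC C1 CM] CM' [c [s [Cc Ms /eqP]]].
rewrite -[_ == _]/(_ == _) eq_sym => /eqP /(canRL (divfK (phi_neq0 Ms))).
rewrite -rmorphM => /phi_inj cE; move: Cc; rewrite cE => /CM[]// Cs.
by case: Ms; apply: CM'.
Qed.

Let ext_prime C : is_prime_ideal setT C -> C `<=` [set a | M (phi a)] ->
  is_prime_ideal B (ext C).
Proof.
move=> pC CM; have [iC C1 CP] := pC.
have iE : is_ideal B (ext C).
  split.
  - by move=> _ [a [s [_ Ms ->]]]; case: (hB) => _ _; apply=> //; apply: unitB.
  - by exists 0, 1; rewrite !rmorph1 rmorph0 mul0r; split=> //; apply: ideal0 iC.
  - move=> _ _ [a [s [Ca Ms ->]]] [b [t [Cb Mt ->]]].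
    exists (a * t + b * s), (s * t); split; last 2 first.
    + exact: notM_mul.
    + by rewrite addf_div ?phi_neq0 // !rmorphM rmorphD !rmorphM.
    by apply: (idealD iC); apply: (idealMr iC).
  - move=> b _ /Bphi[c [t [Mt ->]]] [a [s [Ca Ms ->]]].
    exists (c * a), (t * s); split; first exact: (idealMl iC).
      exact: notM_mul.
    by rewrite mulf_div !rmorphM.
split=> // [|x y Bx By].
  by rewrite -(rmorph1 phi) => /(ext_numerator pC CM).
have [[a [s [Ms ->]]] [b [t [Mt ->]]]] := (Bphi Bx, Bphi By).
rewrite mulf_div => Exy; have : ext C (phi (a * b)).
  rewrite rmorphM -[_ * _](divfK (mulf_neq0 (phi_neq0 Ms) (phi_neq0 Mt))).
  by apply: (idealMr iE) => //; rewrite -rmorphM.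
move/(ext_numerator pC CM)/CP => [//|//|Ca|Cb].
  by left; exists a, s.
by right; exists b, t.
Qed.

Let ext_lt C C' : is_prime_ideal setT C -> C' `<=` [set a | M (phi a)] ->
  C `<` C' -> ext C `<` ext C'.
Proof.
move=> pC C'M [CC' C'C]; split=> [_ [a [s [/CC' Ca Ms ->]]]|E]; first by exists a, s.
apply: C'C => a C'a; apply: (ext_numerator pC); first exact: subset_trans C'M.
apply: E; exists a, 1; rewrite rmorph1 divr1; split=> //.
Qed.

(** The chain [C] extends to [B]. For the upper bound, elements outside [M] are units, so [fs] stays
    independent modulo the top prime of any chain of length [d']; this yields [d' + e] independent
    elements, at most [n = d + e]. *)
Let local_krull_dim d e (C : nat -> set A) fs :
  (d + e)%N = n -> prime_chain setT d C -> C d = [set a | M (phi a)] ->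
  alg_indep iota [set a | M (phi a)] fs -> size fs = e -> krull_dim B d.
Proof.
move=> den [pC ltC] Cd ind sfs.
have CM i : (i <= d)%N -> C i `<=` [set a | M (phi a)].
  rewrite -Cd; elim: d ltC {den pC Cd} => [|d IHd] ltC; first by rewrite leqn0 => /eqP->.
  rewrite leq_eqVlt => /predU1P[->//|]; rewrite ltnS => /(IHd (fun l ld => ltC l (ltnW ld))).
  by move/subset_trans; apply; case: (ltC d).
split.
  exists (ext \o C); split=> i id; first exact: (ext_prime (pC i id) (CM i id)).
  exact: (ext_lt (pC i (ltnW id)) (CM _ id) (ltC i id)).
move=> d' [P [pP ltP]]; have iP := prime_ideal_ideal (pP d' (leqnn _)).
have gsB g : g \in map phi fs -> B g by case/mapP=> a _ ->.
have indP : alg_indep phi_iotaC (P d') (map phi fs).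
  move=> _ /(@nzval_map_ex _ _ _ iota phi_iotaC phi (fun=> erefl))[a [/ind Ma ->]] Pa.
  by case: (pP d' (leqnn _)) => _ + _; apply; apply: ideal_unit Pa Ma.
have iB c : B (phi_iotaC c) by apply: phiB.
have [hs [shs hsB ind0]] := prime_chain_alg_indep hB iB pP ltP gsB indP.
have : (size (hs ++ map phi fs) <= n)%N.
  apply: (@alg_indep_size _ _ _ _ j_inj phi_iotaC phi_iota) => [g|y hy /= y0].
    by rewrite mem_cat => /orP[/hsB|/gsB]; apply: Bj.
  apply: (ind0 y hy); rewrite y0; exact: ideal0 (prime_ideal_ideal (pP 0 isT)).
by rewrite size_cat size_map shs sfs -den leq_add2r.
Qed.

Lemma regular_localization : regular_local_ring B.
Proof.
split; [exact: subring_set_closed|exact: local_noetherian|].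
exists M; split; first exact: units_local_ring.
have [d [e [C [gs [fs [den [hC Cd] [[gsM genM] sgs] [ind sfs]]]]]]] := rA.2 _ pre_prime.
exists (size (map phi gs)); split.
  by rewrite size_map sgs; apply: (local_krull_dim den hC Cd ind sfs).
exists (fun i => (map phi gs)`_i).
apply: span_range_nth => // [_ /mapP[a /gsM Ma ->]//|K hK gsK].
apply: (ideal_from_numerators hK iM) => a /genM[s [Ms /(_ _ (pre_ideal hK)) hs]].
rewrite -[phi a](mulKf (phi_neq0 Ms)); apply: (idealMl hK); first exact: unitB.
by rewrite -rmorphM; apply: hs => g ggs; apply/gsK/map_f.
Qed.

End RegularLocalRing.

(** * Stalks of the blowup *)

Section IdealPowers.
Variable A : comNzRingType.
Implicit Type I : set A.

Lemma ideal_gen_ideal (E : set A) : is_ideal setT (ideal_gen E).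
Proof. exact: span_ideal. Qed.

Lemma ideal_gen_min (E J : set A) : is_ideal setT J -> E `<=` J -> ideal_gen E `<=` J.
Proof. exact: span_min. Qed.

Lemma mem_ideal_gen (E : set A) x : E x -> ideal_gen E x.
Proof. exact: mem_span. Qed.

Lemma ideal_pow_ideal I q : is_ideal setT (ideal_pow I q).
Proof. by case: q => [|q]; [split|apply: ideal_gen_ideal]. Qed.

Lemma ideal_powS I q x y : I x -> ideal_pow I q y -> ideal_pow I q.+1 (x * y).
Proof. by move=> Ix Iy; apply: mem_ideal_gen; exists x => //; exists y. Qed.

Lemma ideal_powSP I q (J : set A) : is_ideal setT J ->
  (forall x y, I x -> ideal_pow I q y -> J (x * y)) -> ideal_pow I q.+1 `<=` J.
Proof. by move=> iJ IJ; apply: ideal_gen_min => // _ [x Ix [y Iy <-]]; apply: IJ. Qed.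

Lemma ideal_powM I p q x y :
  ideal_pow I p x -> ideal_pow I q y -> ideal_pow I (p + q) (x * y).
Proof.
move=> Ix Iy; elim: p x Ix => [|p IHp] x Ix.
  by apply: (idealMl (ideal_pow_ideal I q)).
pose J := [set x | ideal_pow I (p.+1 + q) (x * y)].
apply: (ideal_powSP (J := J)) Ix => [|x1 x2 Ix1 Ix2]; last first.
  by rewrite /J /= -mulrA; apply: ideal_powS => //; apply: IHp.
have iP := ideal_pow_ideal I (p.+1 + q); split=> //.
- by rewrite /J /= mul0r; apply: ideal0 iP.
- by move=> a b; rewrite /J /= mulrDl; apply: (idealD iP).
- by move=> b a _; rewrite /J /= -mulrA; apply: (idealMl iP).
Qed.

Lemma ideal_powX I x q : I x -> ideal_pow I q (x ^+ q).
Proof. by move=> Ix; elim: q => // q IHq; rewrite exprS; apply: ideal_powS. Qed.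

End IdealPowers.

Section MorphismQuotients.
Variables (A : comNzRingType) (F : fieldType) (j : {rmorphism A -> F}).
Implicit Types a b c d : A.

Lemma rmorph_quotD a b c d : j b != 0 -> j d != 0 ->
  j a / j b + j c / j d = j (a * d + c * b) / j (b * d).
Proof. by move=> b0 d0; rewrite addf_div // !(rmorphD, rmorphM). Qed.

Lemma rmorph_quotB a b c d : j b != 0 -> j d != 0 ->
  j a / j b - j c / j d = j (a * d - c * b) / j (b * d).
Proof.
move=> b0 d0; rewrite -mulNr -(rmorphN j) rmorph_quotD //.
by rewrite mulNr.
Qed.

Lemma rmorph_quotM a b c d : (j a / j b) * (j c / j d) = j (a * c) / j (b * d).
Proof. by rewrite mulf_div !rmorphM. Qed.

Lemma rmorph_quot1 a b : j b != 0 -> 1 = j a / j b -> j a = j b.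
Proof. by move=> b0 E; rewrite -(divfK b0 (j a)) -E mul1r. Qed.

End MorphismQuotients.

Section Rees.
Variable A : idomainType.
Implicit Types (I : set A) (P : set {poly A}) (a b : A).

Lemma rees_subring I : subring_set (rees I).
Proof.
split=> [[|i]|p q Ip Iq i|p q Ip Iq i].
- by [].
- by rewrite coef1; apply: ideal0 (ideal_pow_ideal I _).
- by rewrite coefB; apply: (idealB (ideal_pow_ideal I i)).
- rewrite coefM; apply: (ideal_sum (ideal_pow_ideal I i)) => l _.
  by have := ideal_powM (Ip l) (Iq (i - l)%N); rewrite subnKC // -ltnS.
Qed.

Lemma rees_monomial I i a : ideal_pow I i a -> rees I (a *: 'X^i).
Proof.
move=> Ia l; rewrite coefZ coefXn; have [->|_] := eqVneq l i; first by rewrite mulr1.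
by rewrite mulr0; apply: ideal0 (ideal_pow_ideal I l).
Qed.

Lemma scaleXnM a b i l : (a *: 'X^i) * (b *: 'X^l) = (a * b) *: 'X^(i + l) :> {poly A}.
Proof. by rewrite -scalerAl -scalerAr scalerA -exprD. Qed.

End Rees.

(* For F the fraction field of {poly A} and j the inclusion of A, this is the
   stalk of the blowup, see blowup_stalkE. *)
Section Stalk.
Variables (A : idomainType) (F : fieldType) (j : {rmorphism A -> F}).
Variables (j_inj : injective j) (I : set A) (P : set {poly A}).
Implicit Types a b : A.

Definition stalk : set F :=
  [set z | exists i a b, [/\ ideal_pow I i a, ideal_pow I i b,
    ~ P (b *: 'X^i) & z = j a / j b]].
Local Notation B := stalk.

Definition stalk_ideal : set F :=
  [set z | exists i a b, [/\ ideal_pow I i a /\ P (a *: 'X^i), ideal_pow I i b,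
    ~ P (b *: 'X^i) & z = j a / j b]].
Local Notation M := stalk_ideal.

Hypothesis pP : is_prime_ideal (rees I) P.
Let iP := prime_ideal_ideal pP.

Lemma notin_prime_neq0 b i : ~ P (b *: 'X^i) -> j b != 0.
Proof.
move=> Pb; rewrite -(rmorph0 j) (inj_eq j_inj); apply/eqP => b0; apply: Pb.
by rewrite b0 scale0r; apply: ideal0 iP.
Qed.

Lemma notin_primeM a b i l : ideal_pow I i a -> ideal_pow I l b ->
  ~ P (a *: 'X^i) -> ~ P (b *: 'X^l) -> ~ P ((a * b) *: 'X^(i + l)).
Proof.
by move=> Ia Ib Pa Pb; rewrite -scaleXnM; apply: (prime_notM pP) => //; apply: rees_monomial.
Qed.

Lemma stalk_subring : subring_set B.
Proof.
split=> [|x y|x y].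
- exists 0%N, 1, 1; rewrite rmorph1 divr1 scale1r expr0.
  by split=> //; case: pP.
- move=> [i [a [b [Ia Ib Pb ->]]]] [l [c [d [Ic Id Pd ->]]]].
  exists (i + l)%N, (a * d - c * b), (b * d); split.
  + apply: (idealB (ideal_pow_ideal I _)) => //; first exact: ideal_powM.
    by rewrite mulrC; apply: ideal_powM.
  + exact: ideal_powM.
  + exact: notin_primeM.
  have [b0 d0] := (notin_prime_neq0 Pb, notin_prime_neq0 Pd).
  exact: rmorph_quotB.
- move=> [i [a [b [Ia Ib Pb ->]]]] [l [c [d [Ic Id Pd ->]]]].
  exists (i + l)%N, (a * c), (b * d); split.
  + exact: ideal_powM.
  + exact: ideal_powM.
  + exact: notin_primeM.
  exact: rmorph_quotM.
Qed.

Lemma stalk_ideal_ideal : is_ideal B M.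
Proof.
split=> [z||x y|x y].
- by case=> i [a [b [[Ia _] Ib Pb ->]]]; exists i, a, b.
- exists 0%N, 0, 1; rewrite rmorph1 divr1 rmorph0 scale0r scale1r expr0.
  by split=> //; [split=> //; apply: ideal0 iP|case: pP].
- move=> [i [a [b [[Ia Pa] Ib Pb ->]]]] [l [c [d [[Ic Pc] Id Pd ->]]]].
  exists (i + l)%N, (a * d + c * b), (b * d); split.
  + split.
      apply: (idealD (ideal_pow_ideal I _)) => //; first exact: ideal_powM.
      by rewrite mulrC; apply: ideal_powM.
    rewrite scalerDl; apply: (idealD iP); first rewrite -scaleXnM.
      by apply: (idealMr iP) => //; apply: rees_monomial.
    by rewrite addnC -scaleXnM; apply: (idealMr iP) => //; apply: rees_monomial.
  + exact: ideal_powM.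
  + exact: notin_primeM.
  have [b0 d0] := (notin_prime_neq0 Pb, notin_prime_neq0 Pd).
  exact: rmorph_quotD.
- move=> [i [a [b [Ia Ib Pb ->]]]] [l [c [d [[Ic Pc] Id Pd ->]]]].
  exists (i + l)%N, (a * c), (b * d); split.
  + split; first exact: ideal_powM.
    by rewrite -scaleXnM; apply: (idealMl iP) => //; apply: rees_monomial.
  + exact: ideal_powM.
  + exact: notin_primeM.
  exact: rmorph_quotM.
Qed.

Lemma stalk_ideal_proper : ~ M 1.
Proof.
case=> i [a [b [[_ Pa] _ Pb /(rmorph_quot1 (notin_prime_neq0 Pb))]]].
by move/j_inj=> abE; apply: Pb; rewrite -abE.
Qed.

Lemma stalk_unit z : B z -> ~ M z -> B z^-1.
Proof.
move=> [i [a [b [Ia Ib Pb ->]]]] Mz.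
exists i, b, a; rewrite invf_div; split=> // Pa; apply: Mz.
by exists i, a, b.
Qed.

End Stalk.

Section BlowupStalk.
Variable A : idomainType.

Definition frac_const : {rmorphism A -> {fraction {poly A}}} :=
  (@tofrac {poly A}) \o polyC.

Lemma frac_const_inj : injective frac_const.
Proof. by move=> a b /eqP; rewrite /= tofrac_eq => /eqP/polyC_inj. Qed.

Lemma tofrac_scaleXn (a b : A) i :
  tofrac (a *: 'X^i) / tofrac (b *: 'X^i) = frac_const a / frac_const b.
Proof.
rewrite -!mul_polyC !tofracM -mulf_div divff ?mulr1 //.
by rewrite tofrac_eq0 -size_poly_eq0 size_polyXn.
Qed.

Lemma blowup_stalkE (I : set A) P : blowup_stalk I P = stalk frac_const I P.
Proof.
apply/seteqP; split=> z [i [a [b [Ia Ib Pb zE]]]]; exists i, a, b; split=> //.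
  by rewrite zE tofrac_scaleXn.
by rewrite zE (tofrac_scaleXn a b i).
Qed.

End BlowupStalk.

(** * Charts of the blowup of a monomial ideal *)

Section MonomialSupport.
Variables (k : fieldType) (n : nat).
Local Notation R := {mpoly k[n]}.

Lemma supp_ideal (U : set 'X_{1..n}) : (forall m m', U m -> U (m + m')%MM) ->
  is_ideal setT [set a : R | forall m, m \in msupp a -> U m].
Proof.
move=> upU; split=> //= [m|x y Ux Uy m|b x _ Ux m].
- by rewrite msupp0.
- by move/msuppD_le; rewrite mem_cat => /orP[/Ux|/Uy].
- move/msuppM_le => /allpairsP[[m1 m2] /= [_ /Ux Um2 ->]].
  by rewrite addmC; apply: upU.
Qed.

Lemma monomial_ideal_supp (E : set 'X_{1..n}) (a : R) m :
  ideal_gen [set 'X_[m] | m in E] a -> m \in msupp a ->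
  exists2 m', E m' & (m' <= m)%MM.
Proof.
have iU : is_ideal setT [set a : R | forall m, m \in msupp a ->
    exists2 m', E m' & (m' <= m)%MM].
  apply: (@supp_ideal [set m | exists2 m', E m' & (m' <= m)%MM]) => m1 m2 [m' Em' m'm].
  by exists m' => //; apply: lepm_trans m'm (lem_addr _ _).
move=> Ea; apply: (ideal_gen_min iU) Ea m => _ [m' Em' <-] m.
by rewrite msuppX inE => /eqP ->; exists m' => //; apply: lepm_refl.
Qed.

End MonomialSupport.

Section MonomialPowers.
Variables (k : fieldType) (n r : nat) (u : 'I_r -> 'X_{1..n}).
Local Notation R := {mpoly k[n]}.

Definition monomial_gen : set R := ideal_gen (range (fun l => 'X_[u l])).
Local Notation I := monomial_gen.

Definition usum (s : seq 'I_r) : 'X_{1..n} := (\sum_(l <- s) u l)%MM.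

Lemma monomial_gen_supp a m : I a -> m \in msupp a -> exists l, (u l <= m)%MM.
Proof.
rewrite /I -(image_comp u (fun m => 'X_[m])) => Ia ma.
by have [_ [l _ <-] lm] := monomial_ideal_supp Ia ma; exists l.
Qed.

Lemma ideal_pow_supp q a m : ideal_pow I q a -> m \in msupp a ->
  exists s, size s = q /\ (usum s <= m)%MM.
Proof.
elim: q a m => [|q IHq] a m Ia ma.
  by exists [::]; rewrite /usum big_nil; split=> //; apply/mnm_lepP => i; rewrite mnm0E.
have iU : is_ideal setT [set a : R | forall m, m \in msupp a ->
    exists s, size s = q.+1 /\ (usum s <= m)%MM].
  apply: (@supp_ideal _ _ [set m | exists s, size s = q.+1 /\ (usum s <= m)%MM]).
  by move=> m1 m2 [s [ss sm]]; exists s; split=> //; apply: lepm_trans sm (lem_addr _ _).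
apply: (ideal_powSP iU) Ia m ma => x y Ix Iy m /msuppM_le /allpairsP[[m1 m2] /= [m1x m2y ->]].
have [[l lm1] [s [<- sm2]]] := (monomial_gen_supp Ix m1x, IHq _ _ Iy m2y).
exists (l :: s); split=> //; rewrite /usum big_cons; apply/mnm_lepP => c.
by rewrite !mnmDE leq_add //; apply/mnm_lepP.
Qed.

Lemma monomial_gen_gen l : I 'X_[u l].
Proof. by apply: mem_ideal_gen; exists l. Qed.

Lemma ideal_pow_usum s : ideal_pow I (size s) 'X_[usum s].
Proof.
elim: s => [|l s IHs]; first by [].
by rewrite /usum big_cons mpolyXD; apply: ideal_powS IHs; apply: monomial_gen_gen.
Qed.

(** If [P] contained every generator of [I] placed in degree 1, it would contain all homogeneous
    elements of positive degree, hence the irrelevant ideal. *)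
Lemma blowup_point_chart P : blowup_point I P -> exists i, ~ P ('X_[u i] *: 'X).
Proof.
move=> [pP _ nirr]; apply: contrapT => /forallNP uP; apply: nirr => p [Ip p0].
have iP := prime_ideal_ideal pP.
have iJ i (y : R) : ideal_pow I i y -> is_ideal setT [set a : R | P ((a * y) *: 'X^(i.+1))].
  move=> Iy; split=> //=.
  - by rewrite mul0r scale0r; apply: ideal0 iP.
  - by move=> a b; rewrite mulrDl scalerDl; apply: (idealD iP).
  - move=> b a _ Pa; rewrite -mulrA -[i.+1]add0n -scaleXnM; apply: (idealMl iP) => //.
    exact: rees_monomial.
have iL i : is_ideal setT [set a : R | P (a *: 'X^i)].
  split=> //=.
  - by rewrite scale0r; apply: ideal0 iP.
  - by move=> a b; rewrite scalerDl; apply: (idealD iP).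
  - move=> b a _ Pa; rewrite -[i]add0n -scaleXnM; apply: (idealMl iP) => //.
    exact: rees_monomial.
rewrite -[p]coefK poly_def; apply: (ideal_sum iP) => -[[|i] /= _] _.
  by rewrite p0 scale0r; apply: ideal0 iP.
apply: (ideal_powSP (iL i.+1)) (Ip i.+1) => x y Ix Iy.
apply: (ideal_gen_min (iJ i y Iy)) Ix => _ [l _ <-] /=.
rewrite -[i.+1]add1n -scaleXnM expr1; apply: (idealMr iP); first exact: rees_monomial.
exact: contrapT (uP l).
Qed.

End MonomialPowers.

Arguments monomial_gen k {n r} u _.

Section Chart.
Variables (k : fieldType) (n r : nat) (u : 'I_r -> 'X_{1..n}).
Variables (F : fieldType) (j : {rmorphism {mpoly k[n]} -> F}) (j_inj : injective j).
Local Notation I := (monomial_gen k u).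

Lemma inj_monomial_neq0 m : j 'X_[m] != 0.
Proof.
by rewrite -(rmorph0 j) (inj_eq j_inj) -(mmeasure_poly_eq0 mdeg) mmeasureX.
Qed.

Lemma subring_monomial (C : set F) m : subring_set C ->
  (forall c, C (j 'X_c)) -> C (j 'X_[m]).
Proof.
move=> hC CX; rewrite mpolyXE_id rmorph_prod; apply: (subring_set_prod hC) => c _.
by rewrite rmorphXn; apply: (subring_setX hC).
Qed.

Section Dehomogenization.
Variables (C : set F) (hC : subring_set C) (i : 'I_r).
Hypotheses (Ck : forall c, C (j c%:MP)) (CX : forall c, C (j 'X_c))
  (Cu : forall l, C (j 'X_[u l] / j 'X_[u i])).

Lemma dehomogenize_usum s : C (j 'X_[usum u s] / j 'X_[u i] ^+ size s).
Proof.
elim: s => [|l s IHs].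
  by rewrite /usum big_nil mpolyX0 rmorph1 divr1; case: hC.
rewrite /usum big_cons mpolyXD rmorphM /= exprS -mulf_div.
by case: (hC) => _ _; apply.
Qed.

(** Each monomial of an element of the [q]-th power of [I] is a monomial times [q] generators, and
    each of these is divided by one factor ['X_[u i]]. *)
Lemma dehomogenize q a : ideal_pow I q a -> C (j a / j 'X_[u i] ^+ q).
Proof.
move=> Ia; have Cmul x y : C x -> C y -> C (x * y) by case: hC => _ _; apply.
have -> : j a / j 'X_[u i] ^+ q =
    \sum_(m <- msupp a) j (a@_m)%:MP * (j 'X_[m] / j 'X_[u i] ^+ q).
  rewrite [in LHS](mpolyE a) rmorph_sum mulr_suml; apply: eq_bigr => m _.
  by rewrite -mul_mpolyC rmorphM mulrA.
rewrite big_seq; elim/big_rec: _ => [|m x ma Cx]; first exact: subring_set0 hC.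
apply: (subring_setD hC) => //; apply: (Cmul) => //.
have [s [sq sm]] := ideal_pow_supp Ia ma.
rewrite -sq.
rewrite -(submK sm) mpolyXD rmorphM -mulrA; apply: (Cmul); last exact: dehomogenize_usum.
exact: subring_monomial.
Qed.

End Dehomogenization.

(* The stalk is then a localization of a polynomial ring in n variables, which
   map to zs. *)
Lemma regular_stalk P i (zs : seq F) : is_prime_ideal (rees I) P ->
  ~ P ('X_[u i] *: 'X) -> size zs = n ->
  (forall z, z \in zs -> stalk j I P z) ->
  (forall C : set F, subring_set C -> (forall z, z \in zs -> C z) ->
     (forall c, C (j c%:MP)) ->
     (forall c, C (j 'X_c)) /\ forall l, C (j 'X_[u l] / j 'X_[u i])) ->
  regular_local_ring (stalk j I P).
Proof.
move=> pP Pi szs zsB zsC; pose B := stalk j I P; pose M := stalk_ideal j I P.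
have [|A [iota [phi [psi [[phiE psiE] [phiA zsE] rA [_ psiN]]]]]] :=
  @regular_algebra k n F (j \o @mpolyC n k) zs [seq 'X_c | c <- enum 'I_n].
  by rewrite szs size_map size_enum_ord.
rewrite szs in rA; have hB : subring_set B := stalk_subring j_inj pP.
have iM : is_ideal B M := stalk_ideal_ideal j_inj pP.
have M1 : ~ M 1 := stalk_ideal_proper j_inj pP.
have unitB b : B b -> ~ M b -> B b^-1 := @stalk_unit _ _ j I P b.
have rphi : subring_set (range phi).
  split; first by exists 1; rewrite ?rmorph1.
    by move=> _ _ [a _ <-] [b _ <-]; exists (a - b); rewrite ?rmorphB.
  by move=> _ _ [a _ <-] [b _ <-]; exists (a * b); rewrite ?rmorphM.
have kphi c : range phi (j c%:MP) by exists (iota c); rewrite ?phiE.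
have zphi z : z \in zs -> range phi z by move=> /zsE[a <-]; exists a.
have [Xphi uphi] := zsC _ rphi zphi kphi.
have constB a : B (j a).
  exists 0%N, a, 1; rewrite rmorph1 divr1 scale1r expr0.
  by split=> //; case: pP.
have phiB a : B (phi a) by apply: algval_sub (phiA a) => // c; apply: constB.
have phi_inj : injective phi.
  apply: (regular_algebra_injective j_inj phiE psiE) => [a a0|c].
    apply/eqP => pa0; apply: (mpolyX_alg_indep (enum_uniq 'I_n)) (psiN a a0) pa0.
  by have [a _ aX] := Xphi c; exists a.
apply: (regular_localization j_inj hB iM M1 unitB _ phi_inj phiE phiB _ rA).
  move=> b [q [a [c [_ _ Pc ->]]]]; exists a, c; split.
    by apply/eqP => c0; case/eqP: (notin_prime_neq0 j_inj pP Pc); rewrite c0 rmorph0.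
  by rewrite divfK // (notin_prime_neq0 j_inj pP Pc).
move=> b [q [a [c [Ia Ic Pc ->]]]].
have [e _ eE] := dehomogenize rphi kphi Xphi uphi Ia.
have [s _ sE] := dehomogenize rphi kphi Xphi uphi Ic.
have u0 : j 'X_[u i] ^+ q != 0 by rewrite expf_neq0 // inj_monomial_neq0.
(* Numerator and denominator are divided by the same power of ['X_[u i]]. The new denominator is
   outside [M] because its inverse ['X_[u i] ^+ q / c] lies in the stalk. *)
exists e, s; rewrite eE sE; split; last first.
  by rewrite invf_div mulrA divfK.
move=> Ms; apply: M1; rewrite -(divff (notin_prime_neq0 j_inj pP Pc)).
have -> : j c / j c = (j c / j 'X_[u i] ^+ q) * (j 'X_[u i] ^+ q / j c).
  by rewrite mulrA divfK.
apply: (idealMr iM) => //; exists q, ('X_[u i] ^+ q), c; rewrite rmorphXn; split=> //.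
exact/ideal_powX/monomial_gen_gen.
Qed.

End Chart.

(** * Exchange properties of families of sets *)

Section ExchangeProperties.
Variables (T : finType) (r : nat) (W : 'I_r -> {set T}).

Definition antichain : Prop := forall i g, W g \subset W i -> g = i.

Definition exchange : Prop := forall i l c, c \in W i -> c \notin W l ->
  exists g d, [/\ W g :\: W i = [set d]%SET, d \in W l & c \notin W g].

Definition unique_exchange : Prop := forall i g g' d,
  W g :\: W i = [set d]%SET -> W g' :\: W i = [set d]%SET -> g = g'.

Lemma setD1P g i d x : W g :\: W i = [set d]%SET -> (x \notin W i) && (x \in W g) = (x == d).
Proof. by move/setP/(_ x); rewrite !inE. Qed.

Lemma setD1_mem g i d : W g :\: W i = [set d]%SET -> d \in W g /\ d \notin W i.
Proof. by move/(setD1P d); rewrite eqxx => /andP[]. Qed.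

(** Exchange applied to [d], from [W g] towards [W i], gives [h] with [W h] contained in [W i].
    Hence [h = i], and the single new element [e] of [W h] is all of [W i :\: W g]. *)
Lemma exchange_swap i g d : antichain -> exchange ->
  W g :\: W i = [set d]%SET -> exists c, W i :\: W g = [set c]%SET.
Proof.
move=> anti exch gi; have [dg di] := setD1_mem gi.
have [h [e [hg ei dh]]] := exch g i d dg di; exists e.
have -> // : i = h; apply/esym/anti/fintype.subsetP => x xh.
have [xg|xg] := boolP (x \in W g).
  apply: contraT => xi; have := setD1P x gi.
  by rewrite xi xg => /esym/eqP xd; rewrite -xd xh in dh.
by have := setD1P x hg; rewrite xg xh => /esym/eqP ->.
Qed.

End ExchangeProperties.

(** * Polynomial coordinates on the charts *)

Section SquarefreeCharts.
Variables (k : fieldType) (n r : nat) (u : 'I_r -> 'X_{1..n}).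
Variables (m0 : 'X_{1..n}) (W : 'I_r -> {set 'I_n}).
Hypothesis uE : forall l c, u l c = (m0 c + (c \in W l))%N.
Hypotheses (antiW : antichain W) (exW : exchange W) (unW : unique_exchange W).
Local Notation I := (monomial_gen k u).

Section Chart.
Variables (F : fieldType) (j : {rmorphism {mpoly k[n]} -> F}) (j_inj : injective j).
Variable i : 'I_r.

(* When W g \ W i = {c}, the coordinate at c is X_c / X_d with
   W i \ W g = {d}. *)
Definition chart_coordinate (c : 'I_n) : F :=
  if [pick g | W g :\: W i == [set c]%SET] is Some g then j 'X_[u g] / j 'X_[u i]
  else j 'X_c.

Local Notation z := chart_coordinate.

Lemma chart_coordinate_in c : c \in W i -> z c = j 'X_c.
Proof.
move=> ci; rewrite /z; case: pickP => // g /eqP/setD1_mem[_].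
by rewrite ci.
Qed.

Lemma chart_coordinate_edge g d c :
  W g :\: W i = [set d]%SET -> W i :\: W g = [set c]%SET -> j 'X_d = z d * j 'X_c.
Proof.
move=> gi ig; rewrite /z; case: pickP => [g' /eqP g'i|/(_ g)]; last by rewrite gi eqxx.
rewrite (unW g'i gi) mulrAC; apply: (canRL (mulfK (inj_monomial_neq0 j_inj _))).
rewrite -!rmorphM -!mpolyXD; congr (j 'X_[_]); apply/mnmP => x.
rewrite !mnmDE !mnm1E !uE (eq_sym d) (eq_sym c) -(setD1P x gi) -(setD1P x ig).
by case: (x \in W g); case: (x \in W i); lia.
Qed.

(** Either ['X_d] is itself a coordinate, or it is [z d * 'X_c] with [c] in [W i], where the
    coordinate at [c] is ['X_c]. *)
Lemma chart_variable (C : set F) : subring_set C -> (forall c, C (z c)) ->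
  forall c, C (j 'X_c).
Proof.
move=> hC Cz d; have [[g gi]|none] := pselect (exists g, W g :\: W i = [set d]%SET).
  have [c ig] := exchange_swap antiW exW gi.
  rewrite (chart_coordinate_edge gi ig); case: (hC) => _ _; apply=> //.
  by rewrite -chart_coordinate_in //; case: (setD1_mem ig).
suff -> : j 'X_d = z d by [].
by rewrite /z; case: pickP => // g /eqP gi; case: none; exists g.
Qed.

(** Exchange pairs each [c] in [W i :\: W l] with some [d c] in [W l :\: W i] such that
    ['X_(d c) = z (d c) * 'X_c], and unique exchange makes the pairing injective. The quotient is
    then the product of the coordinates [z (d c)] and of the unpaired variables. *)
Lemma chart_quotient (C : set F) : subring_set C -> (forall c, C (z c)) ->
  forall l, C (j 'X_[u l] / j 'X_[u i]).
Proof.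
move=> hC Cz l; have CX := chart_variable hC Cz.
pose D := W i :\: W l.
have exd c : exists d, c \in D -> exists g,
    [/\ W g :\: W i = [set d]%SET, W i :\: W g = [set c]%SET & d \in W l].
  have [|cD] := boolP (c \in D); last by exists c.
  rewrite inE => /andP[cl ci]; have [g [d [gi dl cg]]] := exW ci cl.
  exists d => _; exists g; split=> //; have [e ig] := exchange_swap antiW exW gi.
  by have := setD1P c ig; rewrite ci cg ig => /esym/eqP ->.
have [d dP] := choice exd.
have d_inj : {in D &, injective d}.
  move=> c c' /dP[g [gi ig _]] /dP[g' [gi' ig' _]] dE.
  rewrite dE in gi; rewrite (unW gi gi') in ig.
  by apply: set1_inj; rewrite -ig -ig'.
pose rest := (W l :\: W i) :\: [set d c | c in D]%SET.
have sum1 (S : {set 'I_n}) x : (\sum_(c in S) U_(c)%MM x = (x \in S))%N.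
  rewrite big_mkcond (bigD1 x) //= mnm1E eqxx big1 ?addn0; first by case: (x \in S).
  by move=> c /negPf cx; rewrite mnm1E cx if_same.
(* Denominators are cleared: [D] is what [u i] has and [u l] lacks, and [rest] is the unpaired part
   of [W l :\: W i]. The common exponent [m0] occurs on both sides. *)
have uD : (u l + \sum_(c in D) U_(c) =
    u i + \sum_(c in D) U_(d c) + \sum_(c in rest) U_(c))%MM.
  apply/mnmP => x; rewrite !mnmDE !mnm_sumE !uE !sum1.
  rewrite -(big_imset (fun c => U_(c)%MM x) d_inj) sum1 !inE.
  have [/imsetP[c /dP[g [gi _ dl]] ->]|_] /= := boolP (x \in [set d c | c in D]%SET).
    have [_ di] := setD1_mem gi; rewrite dl (negPf di) /=; lia.
  by case: (x \in W l); case: (x \in W i) => /=; lia.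
have Xsum (S : {set 'I_n}) (f : 'I_n -> 'I_n) :
    j 'X_[(\sum_(c in S) U_(f c))%MM] = \prod_(c in S) j 'X_(f c).
  by rewrite -rmorph_prod; congr (j _); apply: big_morph; [apply: mpolyXD|apply: mpolyX0].
have := congr1 (fun m => j 'X_[m]) uD.
rewrite !mpolyXD !rmorphM (Xsum D id) (Xsum D d) (Xsum rest id).
have -> : \prod_(c in D) j 'X_(d c) = \prod_(c in D) z (d c) * \prod_(c in D) j 'X_c.
  rewrite -big_split /=; apply: eq_bigr => c /dP[g [gi ig _]].
  exact: chart_coordinate_edge gi ig.
set pD := \prod_(c in D) j 'X_c.
have pD0 : pD != 0 by apply/prodf_neq0 => c _; apply: inj_monomial_neq0.
rewrite mulrA mulrAC => /(mulIf pD0) ->; rewrite mulrC -mulrA mulKf ?inj_monomial_neq0 //.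
by case: (hC) => _ _; apply; apply: (subring_set_prod hC).
Qed.

Lemma chart_coordinate_stalk P c : is_prime_ideal (rees I) P ->
  ~ P ('X_[u i] *: 'X) -> stalk j I P (z c).
Proof.
move=> pP Pi; rewrite /z; case: pickP => [g _|_].
  exists 1%N, 'X_[u g], 'X_[u i]; split=> //; have := ideal_powX 1 (monomial_gen_gen k u _).
    by move/(_ g); rewrite expr1.
  by move/(_ i); rewrite expr1.
exists 0%N, 'X_c, 1; rewrite rmorph1 divr1 scale1r expr0; split=> //.
by case: pP.
Qed.

End Chart.

Lemma tame_of_exchange : tame I.
Proof.
move=> P bP; have [i Pi] := blowup_point_chart bP; have [pP _ _] := bP.
rewrite blowup_stalkE; have j_inj := @frac_const_inj {mpoly k[n]}.
set j := frac_const _ in j_inj *.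
pose zs := [seq chart_coordinate j i c | c <- enum 'I_n].
apply: (@regular_stalk _ _ _ u _ j j_inj P i zs) => //.
- by rewrite size_map size_enum_ord.
- by move=> _ /mapP[c _ ->]; apply: chart_coordinate_stalk.
move=> C hC Cz _; have {}Cz c : C (chart_coordinate j i c).
  by apply/Cz/map_f; rewrite mem_enum.
by split=> [c|l]; [apply: (chart_variable j_inj hC Cz)|apply: (chart_quotient j_inj hC Cz)].
Qed.

End SquarefreeCharts.

(** * Vertices of the blowup of a squarefree monomial ideal *)

(** Without its term at [e1], resp. [e2], the factor [a], resp. [b], no longer contributes to the
    coefficient at [t]; expanding the product of the two remainders gives the formula, whose last
    term corrects a double count. *)
Lemma mcoeffM_two (k : fieldType) n (a b : {mpoly k[n]}) (e1 e2 t : 'X_{1..n}) :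
  (forall m1 m2, m1 \in msupp a -> m2 \in msupp b -> (m1 + m2)%MM = t ->
     m1 = e1 \/ m2 = e2) ->
  (a * b)@_t = a@_e1 * ('X_[e1] * b)@_t + b@_e2 * ('X_[e2] * a)@_t
               - a@_e1 * b@_e2 * ((e1 + e2)%MM == t)%:R.
Proof.
move=> h; pose a' := a - a@_e1 *: 'X_[e1]; pose b' := b - b@_e2 *: 'X_[e2].
have suppB (x : {mpoly k[n]}) e m :
    m \in msupp (x - x@_e *: 'X_[e]) -> m \in msupp x /\ m != e.
  rewrite !mcoeff_msupp mcoeffB mcoeffZ mcoeffX; have [->|] := eqVneq e m.
    by rewrite mulr1 subrr eqxx.
  by rewrite mulr0 subr0.
have : (a' * b')@_t = 0.
  apply/eqP; rewrite mcoeff_eq0; apply/negP => /msuppM_le /allpairsP[[m1 m2] /= [m1a m2b te]].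
  have [[m1s /eqP m1e] [m2s /eqP m2e]] := (suppB _ _ _ m1a, suppB _ _ _ m2b).
  by case: (h m1 m2 m1s m2s (esym te)).
have -> : a' * b' = a * b - a@_e1 *: ('X_[e1] * b) - b@_e2 *: ('X_[e2] * a)
    + (a@_e1 * b@_e2) *: 'X_[e1 + e2].
  by rewrite mpolyXD -!mul_mpolyC mpolyCM /a' /b' -!mul_mpolyC; ring.
rewrite mcoeffD !mcoeffB !mcoeffZ mcoeffX => h0.
by apply/eqP; rewrite -subr_eq0 -h0; apply/eqP; ring.
Qed.

Section Necessity.
Variables (k : fieldType) (n r : nat) (w : 'I_r -> 'X_{1..n}) (W : 'I_r -> {set 'I_n}).
Hypotheses (wE : forall l c, w l c = (c \in W l)) (antiW : antichain W).
Variable i : 'I_r.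
Local Notation R := {mpoly k[n]}.
Local Notation I := (monomial_gen k w).

(** The exponents of the monomials that belong to the [q]-th power of the ideal. *)
Definition pow_exponent q (m : 'X_{1..n}) : Prop :=
  exists s, size s = q /\ (usum w s <= m)%MM.

(* The exponents m in question are those for which X_m / X_(w i) is an
   irreducible element of the monoid of monomials of the chart at i. *)
Definition irreducible_exponent (m : 'X_{1..n}) : Prop :=
  [/\ pow_exponent 1 m, m <> w i
    & forall p q m1 m2, pow_exponent p m1 -> pow_exponent q m2 ->
        (m1 + m2 + w i = m + w i *+ (p + q))%MM ->
        m1 = (w i *+ p)%MM \/ m2 = (w i *+ q)%MM].

Lemma usumE s x : usum w s x = (\sum_(l <- s) (x \in W l))%N.
Proof. by rewrite mnm_sumE; apply: eq_bigr => l _; rewrite wE. Qed.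

Lemma usum_const s : count (predC1 i) s = 0%N -> usum w s = (w i *+ size s)%MM.
Proof.
elim: s => [_|l s IHs] /=; first by rewrite /usum big_nil.
have [->|//] := eqVneq l i; rewrite add0n => /IHs; rewrite /usum big_cons => ->.
by apply/mnmP => x; rewrite mnmDE !mulmnE mulnS.
Qed.

Lemma usum_one s : count (predC1 i) s = 1%N ->
  exists l, l != i /\ (usum w s + w i = w l + w i *+ size s)%MM.
Proof.
elim: s => //= l s IHs; have [->|li] := eqVneq l i; rewrite /usum big_cons.
  rewrite add0n => /IHs[l' [l'i E]]; exists l'; split=> //.
  apply/mnmP => x; have /mnmP/(_ x) := E; rewrite !mnmDE !mulmnE mulnS /usum; lia.
rewrite add1n => -[/usum_const E]; exists l; split=> //; rewrite -/(usum w s) E.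
apply/mnmP => x; rewrite !mnmDE !mulmnE mulnS; move: (w i x * size s)%N => y; lia.
Qed.

Lemma outside_exists l : l != i -> exists x, x \in W l :\: W i.
Proof.
move=> li; apply/set0Pn; rewrite finset.setD_eq0; apply: contra_neqN li; exact: antiW.
Qed.

(** By the antichain condition every generator other than [w i] has a variable outside [W i]. *)
Lemma count_outside s : (count (predC1 i) s <= \sum_(x in ~: W i) usum w s x)%N.
Proof.
under eq_bigr do rewrite usumE; rewrite exchange_big /=.
rewrite -sum1_count big_mkcond /=; apply: leq_sum => l _; case: ifP => //= li.
have [x] := outside_exists li; rewrite !inE => /andP[xi xl].
by rewrite (bigD1 x) /= ?inE // xl.
Qed.


Lemma usum_unsplit s : (count (predC1 i) s <= 1)%N ->
  (count (predC1 i) s = 0%N /\ usum w s = (w i *+ size s)%MM) \/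
  exists l, l != i /\ (usum w s + w i = w l + w i *+ size s)%MM.
Proof.
case E: (count _ s) => [|[|//]] _; first by left; split=> //; apply: usum_const.
by right; apply: usum_one.
Qed.

(* A relation m = m1 + m2 in the monoid of the chart in which at most one of the
   generators w l - w i occurs. *)
Lemma irreducible_of_unsplit m : pow_exponent 1 m -> m <> w i ->
  (forall s a, (usum w s + a + w i = m + w i *+ size s)%MM -> (count (predC1 i) s <= 1)%N) ->
  (forall a1 a2, (a1 + a2 + w i = m)%MM -> a1 = 0%MM \/ a2 = 0%MM) ->
  (forall l a, l != i -> (a + w l = m)%MM -> a = 0%MM) ->
  irreducible_exponent m.
Proof.
move=> m1 mi unsplit h0 h1; split=> // p q n1 n2 [s1 [<- s1n]] [s2 [<- s2n]].
rewrite -(submK s1n) -(submK s2n).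
set a1 := (n1 - _)%MM; set a2 := (n2 - _)%MM => E.
have := unsplit (s1 ++ s2) (a1 + a2)%MM; rewrite count_cat size_cat => c12.
have {}c12 : (count (predC1 i) s1 + count (predC1 i) s2 <= 1)%N.
  apply: c12; apply/mnmP => x; have /mnmP/(_ x) := E.
  by rewrite /usum big_cat /= !mnmDE -!/(usum w _); lia.
have [|[c1 E1]|[l1 [l1i E1]]] := @usum_unsplit s1; first lia.
  have [|[c2 E2]|[l2 [l2i E2]]] := @usum_unsplit s2; first lia.
    have [|->|->] := h0 a1 a2; rewrite ?add0m; [|by left|by right].
    apply/mnmP => x; have /mnmP/(_ x) := E; rewrite E1 E2.
    rewrite !mnmDE !mulmnE mulnDr.
    by move: (w i x * size s1)%N (w i x * size s2)%N => y1 y2; lia.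
  have a0 : (a1 + a2)%MM = 0%MM.
    apply: (h1 l2) => //; apply/mnmP => x; have /mnmP/(_ x) := E; have /mnmP/(_ x) := E2.
    rewrite E1 !mnmDE !mulmnE mulnDr.
    by move: (w i x * size s1)%N (w i x * size s2)%N => y1 y2; lia.
  have /andP[/eqP z1 /eqP z2] : (a1 == 0%MM) && (a2 == 0%MM) by rewrite -mnmD_eq0 a0.
  by left; rewrite z1 add0m E1.
have c2 : count (predC1 i) s2 = 0%N.
  suff : count (predC1 i) s1 != 0%N by lia.
  apply/eqP => /usum_const E1'; rewrite E1' in E1.
  have/outside_exists[x] := l1i; rewrite inE => /andP[xi xl].
  by have /mnmP/(_ x) := E1; rewrite !mnmDE !wE (negPf xi) xl; lia.
have a0 : (a1 + a2)%MM = 0%MM.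
  apply: (h1 l1) => //; apply/mnmP => x; have /mnmP/(_ x) := E; have /mnmP/(_ x) := E1.
  rewrite (usum_const c2) !mnmDE !mulmnE mulnDr.
  by move: (w i x * size s1)%N (w i x * size s2)%N => y1 y2; lia.
have /andP[/eqP z1 /eqP z2] : (a1 == 0%MM) && (a2 == 0%MM) by rewrite -mnmD_eq0 a0.
by right; rewrite z2 add0m (usum_const c2).
Qed.

Lemma pow_exponent_gen l a : pow_exponent 1 (w l + a)%MM.
Proof. by exists [:: l]; rewrite /usum big_seq1 lem_addr. Qed.

(** Once relations with two generators other than [w i] are excluded, the antichain condition rules
    out the remaining ones: no generator divides another. *)
Lemma irreducible_gen l : l != i ->
  (forall s a, (usum w s + a + w i = w l + w i *+ size s)%MM -> (count (predC1 i) s <= 1)%N) ->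
  irreducible_exponent (w l).
Proof.
have wle g g' a : (a + w g = w g')%MM -> g = g'.
  move=> E; apply/antiW/fintype.subsetP => x xg; have /mnmP/(_ x) := E.
  by rewrite mnmDE !wE xg; case: (x \in W g') => //; lia.
move=> li unsplit; apply: irreducible_of_unsplit => //.
- by have := pow_exponent_gen l 0%MM; rewrite addm0.
- by move=> E; case/eqP: li; apply: (wle l i 0%MM); rewrite add0m.
- by move=> a1 a2 /wle E; rewrite E eqxx in li.
- move=> l' a l'i E; have := wle _ _ _ E => E'; rewrite E' in E.
  by apply/mnmP => x; have /mnmP/(_ x) := E; rewrite mnmDE mnm0E; lia.
Qed.

Lemma sum_mnm1 (S : {set 'I_n}) c : (\sum_(x in S) U_(c)%MM x = (c \in S))%N.
Proof.
rewrite big_mkcond (bigD1 c) //= mnm1E eqxx big1 ?addn0; first by case: (c \in S).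
by move=> x /negPf cx; rewrite mnm1E eq_sym cx if_same.
Qed.

Lemma count_outside_le s a m : (usum w s + a + w i = m + w i *+ size s)%MM ->
  (count (predC1 i) s <= \sum_(x in ~: W i) m x)%N.
Proof.
move=> E; apply: leq_trans (count_outside s) _; apply: leq_sum => x; rewrite inE => xi.
by have /mnmP/(_ x) := E; rewrite !mnmDE mulmnE wE (negPf xi); lia.
Qed.

(** The exponent of the chart coordinate at [c] multiplied by the generator [w i]. *)
Definition chart_exponent (c : 'I_n) : 'X_{1..n} :=
  if [pick g | W g :\: W i == [set c]%SET] is Some g then w g else (w i + U_(c))%MM.

Lemma gen_outside g c : W g :\: W i = [set c]%SET -> (\sum_(x in ~: W i) w g x = 1)%N.
Proof.
move=> gi; have -> : (\sum_(x in ~: W i) w g x = \sum_(x in [set c]%SET) w g x)%N.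
  rewrite [LHS]big_mkcond [RHS]big_mkcond; apply: eq_bigr => x _.
  by rewrite -gi !inE wE; case: (x \in W g); case: (x \in W i).
by rewrite big_set1 wE; case: (setD1_mem gi) => ->.
Qed.

(** The degree in the variables outside [W i] is at most 1, which leaves room for at most one
    generator other than [w i]. In the second case such a generator would satisfy
    [W l :\: W i = {c}], contrary to the choice made by [pick]. *)
Lemma chart_exponent_irreducible c : irreducible_exponent (chart_exponent c).
Proof.
rewrite /chart_exponent; case: pickP => [g /eqP gi|none].
  have [cg ci] := setD1_mem gi; apply: irreducible_gen.
    by apply: contraNneq ci => <-.
  by move=> s a /count_outside_le; rewrite (gen_outside gi).
have addU_eq0 a1 a2 : (a1 + a2 = U_(c))%MM -> a1 = 0%MM \/ a2 = 0%MM.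
  move=> /(congr1 mdeg); rewrite mdegD mdeg1 => E.
  have [|] : (mdeg a1 = 0 \/ mdeg a2 = 0)%N by lia.
    by move/eqP; rewrite mdeg_eq0 => /eqP; left.
  by move/eqP; rewrite mdeg_eq0 => /eqP; right.
apply: irreducible_of_unsplit.
- exact: pow_exponent_gen.
- by move/mnmP/(_ c); rewrite mnmDE mnm1E eqxx; lia.
- move=> s a /count_outside_le /leq_trans; apply.
  under eq_bigr do rewrite mnmDE; rewrite big_split /= sum_mnm1 big1 ?leq_b1 //.
  by move=> x; rewrite inE wE => /negPf ->.
- move=> a1 a2 E; apply: addU_eq0; apply/mnmP => x; have /mnmP/(_ x) := E.
  by rewrite !mnmDE; lia.
- move=> l a li E; have /negP[] := negbT (none l).
  have [x xl] := outside_exists li; rewrite finset.eqEsubset; apply/andP; split.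
    apply/fintype.subsetP => y; rewrite !inE => /andP[yi yl].
    have /mnmP/(_ y) := E; rewrite !mnmDE mnm1E !wE (negPf yi) yl (eq_sym c).
    by case: (y == c) => //; lia.
  have xc : x = c.
    move: xl; rewrite inE => /andP[xi xl].
    have /mnmP/(_ x) := E; rewrite !mnmDE mnm1E !wE (negPf xi) xl.
    by case: (eqVneq c x) => [->//|_]; lia.
  by rewrite finset.sub1set -xc.
Qed.

Lemma chart_exponent_inj : injective chart_exponent.
Proof.
have main c c' : c \notin W i -> chart_exponent c = chart_exponent c' -> c = c'.
  move=> ci /mnmP/(_ c); rewrite /chart_exponent.
  have -> : (if [pick g | W g :\: W i == [set c]%SET] is Some g then w g
             else (w i + U_(c))%MM) c = 1%N.
    case: pickP => [g /eqP/setD1_mem[cg _]|_]; first by rewrite wE cg.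
    by rewrite mnmDE mnm1E eqxx wE (negPf ci).
  case: pickP => [g /eqP gi|_].
    by rewrite wE; have := setD1P c gi; rewrite ci; case: (c \in W g) => //= /esym/eqP.
  by rewrite mnmDE mnm1E wE (negPf ci); case: eqP.
move=> c c' E; have [ci|/main] := boolP (c \in W i); last exact.
have [c'i|c'i] := boolP (c' \in W i); last by apply/esym/main.
have inW x : x \in W i -> chart_exponent x = (w i + U_(x))%MM.
  by move=> xi; rewrite /chart_exponent; case: pickP => // g /eqP/setD1_mem[_]; rewrite xi.
have /mnmP/(_ c) := E; rewrite !inW // !mnmDE !mnm1E eqxx.
by case: eqP => // _; lia.
Qed.

(** Exchange goes by induction on the size of [W l :\: W i]. If [w l] is irreducible, it is a chart
    exponent and [g = l] works; otherwise a relation for [w l] involves a generator [l'] without [c]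
    and with a smaller difference. For uniqueness, both generators have the chart exponent at
    [d]. *)
Lemma exchange_of_complete :
  (forall m, irreducible_exponent m -> exists c, m = chart_exponent c) ->
  (forall l c, c \in W i -> c \notin W l ->
     exists g d, [/\ W g :\: W i = [set d]%SET, d \in W l & c \notin W g]) /\
  (forall g g' d, W g :\: W i = [set d]%SET -> W g' :\: W i = [set d]%SET -> g = g').
Proof.
move=> complete.
have w_inj g g' : w g = w g' -> g = g'.
  move=> E; apply/antiW/fintype.subsetP => x xg; have /mnmP/(_ x) := E.
  by rewrite !wE xg; case: (x \in W g').
have gen_edge l : l != i -> irreducible_exponent (w l) ->
    exists c, w l = chart_exponent c /\ W l :\: W i = [set c]%SET.
  move=> li /complete[c E]; exists c; split=> //; move: E; rewrite /chart_exponent.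
  case: pickP => [g /eqP gi /w_inj -> //|_ E].
  case/eqP: li; apply/esym/antiW/fintype.subsetP => x xi; have /mnmP/(_ x) := E.
  by rewrite mnmDE !wE xi; case: (x \in W l) => //; lia.
split.
  move=> l; have [N] := ubnP #|W l :\: W i|; elim: N l => // N IHN l lN c ci cl.
  have li : l != i by apply: contraNneq cl => ->.
  have [unsplit|] := pselect (forall s a,
      (usum w s + a + w i = w l + w i *+ size s)%MM -> (count (predC1 i) s <= 1)%N).
    have [d [_ ld]] := gen_edge l li (irreducible_gen li unsplit).
    by exists l, d; split=> //; case: (setD1_mem ld).
  case/existsNP=> s /existsNP[a /not_implyP[E /negP]]; rewrite -ltnNge => cs.
  (* If all members of [s] contained [c], the left side of [E] would have exponent at least
     [size s + 1] at [c], while the right side has [size s]. *)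
  have [l' l's cl'] : exists2 l', l' \in s & c \notin W l'.
    apply/hasP; rewrite -[has _ _]negbK -all_predC; apply/negP => /allP cs'.
    have /mnmP/(_ c) := E; rewrite !mnmDE mulmnE !wE ci (negPf cl) usumE.
    rewrite big_seq (eq_bigr (fun=> 1%N)); last by move=> g /cs' /=; rewrite negbK => ->.
    by rewrite -big_seq sum1_size mul1n /=; lia.
  have l'i : l' != i by apply: contraNneq cl' => ->.
  have s_le x : x \notin W i -> (usum w s x <= w l x)%N.
    by move=> xi; have /mnmP/(_ x) := E; rewrite !mnmDE mulmnE wE (negPf xi); lia.
  have l'l : W l' :\: W i \subset W l :\: W i.
    apply/fintype.subsetP => x; rewrite !inE => /andP[xi xl']; rewrite xi /=.
    have := s_le x xi; rewrite usumE wE (big_rem l') //= xl'.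
    by case: (x \in W l).
  (* A second generator of [s] other than [i] has a variable outside [W i]. If the differences were
     equal, [l'] would have it too, but its exponent in [w l] is at most 1. *)
  have lt_l'l : (#|W l' :\: W i| < #|W l :\: W i|)%N.
    apply: proper_card; rewrite finset.properEneq l'l andbT; apply/eqP => l'lE.
    have : (0 < count (predC1 i) (rem l' s))%N.
      have /permP/(_ (predC1 i)) := perm_to_rem l's; rewrite /= l'i add1n => cE.
      by rewrite cE in cs.
    rewrite -has_count => /hasP[g gs /= gi]; have [x] := outside_exists gi.
    rewrite inE => /andP[xi xg]; have := s_le x xi.
    have : x \in W l' :\: W i.
      rewrite l'lE inE xi /=; have := s_le x xi.
      by rewrite usumE wE (big_rem g) ?(mem_rem gs) //= xg; case: (x \in W l).
    rewrite inE xi /= usumE => xl'; rewrite (big_rem l') //= (big_rem g) //= xl' xg wE.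
    by case: (x \in W l).
  have [|g [d [gi dl' cg]]] := IHN l' _ c ci cl'; first exact: leq_trans lt_l'l lN.
  exists g, d; split=> //; have [dg di] := setD1_mem gi.
  have : d \in W l' :\: W i by rewrite inE di dl'.
  by move/(fintype.subsetP l'l); rewrite inE => /andP[].
move=> g g' d gi gi'.
have edge h : W h :\: W i = [set d]%SET -> w h = chart_exponent d.
  move=> hi; have [dh di] := setD1_mem hi.
  have hni : h != i by apply: contraNneq di => <-.
  have [|c [-> hc]] := gen_edge h hni.
    by apply: irreducible_gen => // s a /count_outside_le; rewrite (gen_outside hi).
  by congr chart_exponent; apply: set1_inj; rewrite -hc hi.
by apply: w_inj; rewrite !edge.
Qed.

End Necessity.

(** * Dimension and cotangent space at the torus-fixed point of a chart *)

Section Dimension.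
Variables (k : fieldType) (n r : nat) (w : 'I_r -> 'X_{1..n}) (i : 'I_r).
Local Notation R := {mpoly k[n]}.
Local Notation I := (monomial_gen k w).
Hypothesis pointed : forall p q m1 m2, pow_exponent w p m1 -> pow_exponent w q m2 ->
  (m1 + m2 = w i *+ (p + q))%MM -> m1 = (w i *+ p)%MM \/ m2 = (w i *+ q)%MM.

(* The coefficient at 1 of the element a / X_(w i)^q of the chart at i. *)
Definition vertex_coeff q (a : R) : k := a@_(w i *+ q).
(* The coefficient at X_m / X_(w i) of the element a / X_(w i)^q. *)
Definition exponent_coeff m q (a : R) : k := (a * 'X_[w i])@_(m + w i *+ q).
Local Notation beta := vertex_coeff.
Local Notation L := exponent_coeff.

Lemma mulmnD (m : 'X_{1..n}) p q : (m *+ (p + q) = m *+ p + m *+ q)%MM.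
Proof. by apply/mnmP => x; rewrite mnmDE !mulmnE mulnDr. Qed.

(** By [pointed] a single pair of exponents contributes, so taking this coefficient is evaluation at
    a point. *)
Lemma vertex_coeffM p q a b : ideal_pow I p a -> ideal_pow I q b ->
  beta (p + q) (a * b) = beta p a * beta q b.
Proof.
move=> Ia Ib; rewrite /beta (@mcoeffM_two _ _ _ _ (w i *+ p)%MM (w i *+ q)%MM).
  rewrite mulmnD eqxx mulr1 [X in _ * X@__ + _]mulrC mcoeffMX.
  by rewrite [X in _ + _ * X@__]mulrC addmC mcoeffMX (mulrC b@__) addrK.
by move=> m1 m2 m1a m2b; apply: (pointed (ideal_pow_supp Ia m1a) (ideal_pow_supp Ib m2b)).
Qed.

(** The Leibniz rule: irreducibility of [m] makes this coefficient a derivation at the vertex. *)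
Lemma exponent_coeffM m p q a b : irreducible_exponent w i m ->
  ideal_pow I p a -> ideal_pow I q b ->
  L m (p + q) (a * b) = beta p a * L m q b + beta q b * L m p a.
Proof.
move=> [_ mi irr] Ia Ib.
rewrite /L -mulrA (@mcoeffM_two _ _ _ _ (w i *+ p)%MM (w i + w i *+ q)%MM).
  have -> : ((w i *+ p + (w i + w i *+ q))%MM == (m + w i *+ (p + q))%MM) = false.
    apply/eqP => E; apply: mi; apply/mnmP => x; have /mnmP/(_ x) := E.
    by rewrite mulmnD !mnmDE; move: ((w i *+ p)%MM x) ((w i *+ q)%MM x) => y z; lia.
  have E1 : (m + w i *+ (p + q) = w i *+ p + (m + w i *+ q))%MM.
    by rewrite mulmnD addmA [RHS]addmA (addmC m).
  have E2 : (m + w i *+ (p + q) = w i *+ q + (m + w i *+ p))%MM.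
    by rewrite mulmnD (addmC (w i *+ p)%MM) addmA [RHS]addmA (addmC m).
  rewrite mulr0 subr0; congr (_ * _ + _ * _).
  - by rewrite mulrC E1 mcoeffMX.
  - by rewrite mcoeffMX.
  by rewrite mpolyXD (mulrC 'X_[w i]) -mulrA mulrC E2 mcoeffMX (mulrC a).
move=> m1 _ m1a /msuppM_le /allpairsP[[m2 m3] /= [m2b + ->]].
rewrite msuppX inE => /eqP -> E.
case: (irr p q m1 m2 (ideal_pow_supp Ia m1a) (ideal_pow_supp Ib m2b)) => [|->|->].
- by rewrite -addmA.
- by left.
- by right; rewrite addmC.
Qed.

Lemma vertex_coeff0 q : beta q 0 = 0.
Proof. exact: mcoeff0. Qed.

(** The kernel of the graded map from the Rees algebra to k[t] that [vertex_coeff] gives in each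
    degree. *)
Definition vertex_point : set {poly R} := [set p | rees I p /\ forall q, beta q p`_q = 0].
Local Notation P := vertex_point.

Lemma vertex_pointE q a : ideal_pow I q a -> P (a *: 'X^q) <-> beta q a = 0.
Proof.
move=> Ia; split=> [[_ /(_ q)]|a0]; first by rewrite coefZ coefXn eqxx mulr1.
split=> [|l]; first exact: rees_monomial.
by rewrite coefZ coefXn; case: eqP => [->|_]; rewrite ?mulr1 ?mulr0 ?vertex_coeff0.
Qed.

Lemma vertex_point_prime : is_prime_ideal (rees I) P.
Proof.
(* [B] is multiplicative on the Rees algebra and takes values in a domain, so its kernel is
   prime. *)
pose B (p : {poly R}) : {poly k} := \poly_(q < size p) beta q p`_q.
have BE p q : (B p)`_q = beta q p`_q.
  rewrite coef_poly; case: ltnP => // /(nth_default 0) ->.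
  by rewrite vertex_coeff0.
have BM p q : rees I p -> rees I q -> B (p * q) = B p * B q.
  move=> Ip Iq; apply/polyP => l; rewrite BE !coefM /beta raddf_sum /=.
  apply: eq_bigr => x _; rewrite !BE -vertex_coeffM // subnKC // -ltnS; exact: ltn_ord.
have PE p : P p <-> rees I p /\ B p = 0.
  split=> -[Ip p0]; split=> //; first by apply/polyP => q; rewrite BE p0 coef0.
  by move=> q; rewrite -BE p0 coef0.
have hR := rees_subring I; split.
- split=> [p []//||p q [Ip p0] [Iq q0]|b p Ib /PE[Ip p0]].
  + split=> [|q]; first exact: subring_set0 hR.
    by rewrite coef0 vertex_coeff0.
  + split=> [|l]; first exact: (subring_setD hR).
    by rewrite coefD /beta mcoeffD -!/(beta _ _) p0 q0 addr0.
  + by apply/PE; rewrite BM // p0 mulr0; split=> //; case: hR => _ _; apply.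
- move=> [_ /(_ 0%N)]; rewrite coef1 /beta mcoeff1 mulm0n eqxx => /eqP.
  by rewrite oner_eq0.
move=> p q Ip Iq /PE[_ /eqP]; rewrite BM // mulf_eq0.
by case/orP => /eqP E; [left|right]; apply/PE.
Qed.

Lemma vertex_blowup_point : blowup_point I P.
Proof.
split; first exact: vertex_point_prime.
  move=> p [Ip p0] q; split=> [|l]; first exact/rees_monomial/Ip.
  by rewrite coefZ coefXn; case: eqP => [->|_]; rewrite ?mulr1 ?mulr0 ?vertex_coeff0.
have I1 : ideal_pow I 1 'X_[w i].
  by rewrite -[X in ideal_pow _ _ X]expr1; apply/ideal_powX/monomial_gen_gen.
move/(_ ('X_[w i] *: 'X^1)) => [].
  split; first exact: rees_monomial.
  by rewrite coefZ coefXn mulr0.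
move=> _ /(_ 1%N); rewrite coefZ coefXn mulr1 /beta mulm1n mcoeffX eqxx => /eqP.
by rewrite oner_eq0.
Qed.

Section Stalk.
Variables (F : fieldType) (j : {rmorphism R -> F}) (j_inj : injective j).
Let pP := vertex_point_prime.
Let B := stalk j I P.
Let M := stalk_ideal j I P.
Let hB : subring_set B := stalk_subring j_inj pP.
Let iM : is_ideal B M := stalk_ideal_ideal j_inj pP.
Let M1 : ~ M 1 := stalk_ideal_proper j_inj pP.
Let unitB b : B b -> ~ M b -> B b^-1 := @stalk_unit _ _ j I P b.

Let constB a : B (j a).
Proof.
exists 0%N, a, 1; rewrite rmorph1 divr1 scale1r expr0.
by split=> //; case: pP.
Qed.

Lemma stalk_dim_le d : has_prime_chain B d -> (d <= n)%N.
Proof.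
move=> [C [pC ltC]]; pose iota : {rmorphism k -> F} := j \o @mpolyC n k.
have iB c : B (iota c) by apply: constB.
have [||fs [<- fsB ind]] := prime_chain_alg_indep (gs := [::]) hB iB pC ltC => //.
  move=> _ [c c0 ->] Cc; have [iC C1 _] := pC d (leqnn d); apply: C1.
  rewrite -(rmorph1 iota) -(mulVf c0) rmorphM; apply: (idealMl iC) => //.
rewrite cats0 in ind.
apply: (@alg_indep_size _ _ _ j j_inj iota (fun=> erefl)) => [f /fsB|y hy /= y0].
  move=> [q [a [b [_ _ Pb ->]]]]; have b0 := notin_prime_neq0 j_inj pP Pb.
  exists a, b; rewrite divfK //; split=> //.
  by apply: contra_neq b0 => ->; rewrite rmorph0.
apply: (ind y hy); rewrite y0; exact: ideal0 (prime_ideal_ideal (pC 0 isT)).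
Qed.

Variables (X : finType) (e : X -> 'X_{1..n}) (e_inj : injective e).
Hypothesis irr : forall x, irreducible_exponent w i (e x).

(* The coefficients at the irreducible monomials are well defined linear forms
   on the cotangent space of the stalk. *)
Let cotangent_coord (z : F) (c : X -> k) : Prop :=
  exists q a b, [/\ ideal_pow I q a /\ ideal_pow I q b,
    beta q b != 0 /\ beta q a = 0, z = j a / j b
    & forall x, L (e x) q a = c x * beta q b].

Let beta_neq0 q b : beta q b != 0 -> j b != 0.
Proof.
move=> b0; rewrite -(rmorph0 j) (inj_eq j_inj); apply: contra_neq b0 => ->.
exact: vertex_coeff0.
Qed.

(** Two fractions for [z] are cross-multiplied; since both numerators vanish at the vertex, the
    Leibniz rule leaves one term on each side. *)
Let coord_uniq z c d : cotangent_coord z c -> cotangent_coord z d -> c =1 d.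
Proof.
move=> [p [a [b [[Ia Ib] [b0 a0] zE cE]]]] [q [a' [b' [[Ia' Ib'] [b'0 a'0] zE' dE]]]] x.
have E : a * b' = a' * b.
  apply: j_inj; rewrite !rmorphM; have := zE'; rewrite zE => /eqP.
  by rewrite (eqr_div _ _ (beta_neq0 b0) (beta_neq0 b'0)) => /eqP.
have := exponent_coeffM (irr x) Ia Ib'; rewrite E addnC (exponent_coeffM (irr x) Ia' Ib).
rewrite a0 a'0 !mul0r !add0r cE dE => H.
by apply: (mulIf (mulf_neq0 b0 b'0)); rewrite mulrA mulrC -H; ring.
Qed.

Let coordD z z' c d : cotangent_coord z c -> cotangent_coord z' d ->
  cotangent_coord (z + z') (fun x => c x + d x).
Proof.
move=> [p [a [b [[Ia Ib] [b0 a0] zE cE]]]] [q [a' [b' [[Ia' Ib'] [b'0 a'0] zE' dE]]]].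
exists (p + q)%N, (a * b' + a' * b), (b * b'); split.
- split; last exact: ideal_powM.
  apply: (idealD (ideal_pow_ideal I _)); first exact: ideal_powM.
  by rewrite mulrC; apply: ideal_powM.
- rewrite vertex_coeffM // mulf_neq0 //; split=> //.
  rewrite /beta mcoeffD -!/(beta _ _) vertex_coeffM // (mulrC a') vertex_coeffM //.
  by rewrite a0 a'0 mul0r mulr0 addr0.
- by rewrite zE zE' (rmorph_quotD _ _ (beta_neq0 b0) (beta_neq0 b'0)).
move=> x; rewrite /L mulrDl mcoeffD -!/(L _ _ _) exponent_coeffM // (mulrC a').
rewrite exponent_coeffM // vertex_coeffM // a0 a'0 cE dE; ring.
Qed.

(** The scalar [b0] is the value of [b] at the vertex. *)
Let coordM z c b : B b -> cotangent_coord z c ->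
  exists b0, cotangent_coord (b * z) (fun x => b0 * c x).
Proof.
move=> [p [a' [b' [Ia' Ib' Pb' ->]]]] [q [a [d [[Ia Id] [d0 a0] zE cE]]]].
have b'0 : beta p b' != 0 by apply/eqP => /(vertex_pointE Ib').
exists (beta p a' / beta p b'), (p + q)%N, (a' * a), (b' * d); split.
- by split; apply: ideal_powM.
- by rewrite !vertex_coeffM // a0 mulr0 mulf_neq0.
- by rewrite zE rmorph_quotM.
move=> x; rewrite exponent_coeffM // vertex_coeffM // a0 cE mul0r addr0.
by rewrite [RHS]mulrACA divfK // mulrC -mulrA (mulrC (beta q d)) mulrA.
Qed.

Let coord_exists z : M z -> exists c, cotangent_coord z c.
Proof.
move=> [q [a [b [[Ia Pa] Ib Pb ->]]]].
have b0 : beta q b != 0 by apply/eqP => /(vertex_pointE Ib).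
exists (fun x => L (e x) q a / beta q b), q, a, b; split=> //.
  by split=> //; apply/(vertex_pointE Ia).
by move=> x; rewrite divfK.
Qed.

Let coord_sum m (z : 'I_m -> F) (c : 'I_m -> X -> k) :
  (forall l, cotangent_coord (z l) (c l)) ->
  cotangent_coord (\sum_l z l) (fun x => \sum_l c l x).
Proof.
elim: m z c => [|m IHm] z c h.
  have b1 : beta 0 1 = 1 by rewrite /beta mcoeff1 mulm0n eqxx.
  exists 0%N, 0, 1; split=> //.
  - by rewrite b1 oner_neq0 vertex_coeff0.
  - by rewrite big_ord0 rmorph0 mul0r.
  - by move=> x; rewrite /L big_ord0 !mul0r mcoeff0.
rewrite big_ord_recl.
have -> : (fun x => \sum_(l < m.+1) c l x) =
    (fun x => c ord0 x + \sum_(l < m) c (lift ord0 l) x).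
  by apply/funext => x; rewrite big_ord_recl.
exact/coordD/IHm.
Qed.

Let coord_exponent x : cotangent_coord (j 'X_[e x] / j 'X_[w i]) (fun y => (e x == e y)%:R).
Proof.
have [[s [s1 sx]] xi _] := irr x.
have I1 : ideal_pow I 1 'X_[e x].
  rewrite -(submK sx) mpolyXD -s1; apply: (idealMl (ideal_pow_ideal I _)) => //.
  exact: ideal_pow_usum.
have I2 : ideal_pow I 1 'X_[w i].
  by have := ideal_pow_usum k w [:: i]; rewrite /usum big_seq1.
have b1 : beta 1 'X_[w i] = 1 by rewrite /beta mulm1n mcoeffX eqxx.
exists 1%N, 'X_[e x], 'X_[w i]; split=> //.
  rewrite b1 oner_neq0; split=> //; rewrite /beta mulm1n mcoeffX.
  by case: eqP xi.
move=> y; rewrite b1 mulr1 /L mulm1n addmC mcoeffMX mcoeffX.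
by [].
Qed.

(** Regularity provides [d <= n] generators of the maximal ideal. The irreducible monomials have
    unit vectors as coordinates, and these are combinations of the [d] coordinate vectors of the
    generators. *)
Lemma card_irreducible_le : regular_local_ring B -> (#|X| <= n)%N.
Proof.
move=> [_ _ [M' [[maxM' locM'] [d [[chain _] [a M'E]]]]]].
have ME : M = M' by apply: locM'; case: (units_local_ring iM M1 unitB).
rewrite -{}ME in M'E; apply: leq_trans (stalk_dim_le chain).
have Ma l : M (a l) by rewrite M'E; apply: mem_span; [case: hB|exists l].
have [ca aP] := choice (fun l => coord_exists (Ma l)).
have zM x : M (j 'X_[e x] / j 'X_[w i]).
  have [q [b [c [[Ib Ic] [c0 b0] -> _]]]] := coord_exponent x.
  exists q, b, c; split=> //; first by split=> //; apply/(vertex_pointE Ib).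
  by move/(vertex_pointE Ic)/eqP; rewrite (negPf c0).
have /choice[C CP] : forall x, exists C : 'I_d -> k, forall y,
    (e x == e y)%:R = \sum_l C l * ca l y.
  move=> x; have := zM x; rewrite M'E => -[m [b [g [bg E]]]].
  have /choice[h hP] : forall l, exists h : 'I_d * k,
      cotangent_coord (b l * g l) (fun y => h.2 * ca h.1 y).
    move=> l; have [Bb [l' _ <-]] := bg l.
    by have [b0 hb] := coordM Bb (aP l'); exists (l', b0).
  have xE := coord_sum hP; rewrite -E in xE.
  exists (fun l => \sum_(l' | (h l').1 == l) (h l').2) => y.
  rewrite (coord_uniq (coord_exponent x) xE y).
  rewrite (partition_big (fun l => (h l).1) xpredT) //=; apply: eq_bigr => l _.
  by rewrite mulr_suml; apply: eq_bigr => l' /eqP ->.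
(* The identity matrix of size [#|X|] factors through dimension [d], whence [#|X| <= d]. *)
pose Cm := \matrix_(x < #|X|, l < d) C (enum_val x) l.
pose Am := \matrix_(l < d, x < #|X|) ca l (enum_val x).
apply: (@mulmx1_min _ _ _ Cm Am); apply/matrixP => x y; rewrite !mxE.
rewrite -(inj_eq enum_val_inj) -(inj_eq e_inj) CP.
by apply: eq_bigr => l _; rewrite !mxE.
Qed.

End Stalk.
End Dimension.

Section NecessityOfExchange.
Variables (k : fieldType) (n r : nat) (w : 'I_r -> 'X_{1..n}) (W : 'I_r -> {set 'I_n}).
Hypotheses (wE : forall l c, w l c = (c \in W l)) (antiW : antichain W).

(** Neither exponent has a variable outside [W i], so all generators below them are [w i]. Hence
    [m1] and [m2] are at least the two multiples of [w i], and the sum forces equality. *)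
Lemma squarefree_pointed i p q m1 m2 : pow_exponent w p m1 -> pow_exponent w q m2 ->
  (m1 + m2 = w i *+ (p + q))%MM -> m1 = (w i *+ p)%MM \/ m2 = (w i *+ q)%MM.
Proof.
move=> [s [<- sm]] [t [<- tm]] E.
have usum0 (s' : seq 'I_r) m : (usum w s' <= m)%MM -> (forall x, x \notin W i -> m x = 0%N) ->
    usum w s' = (w i *+ size s')%MM.
  move=> s'm m0; apply: (@usum_const _ _ w i); apply/eqP; rewrite -leqn0.
  apply: leq_trans (count_outside wE antiW i s') _; rewrite leqn0 sum_nat_eq0.
  apply/forallP => x; apply/implyP; rewrite inE => xi.
  by rewrite -leqn0 -(m0 x xi); apply/mnm_lepP.
have zero x : x \notin W i -> (m1 x + m2 x = 0)%N.
  by move=> xi; have /mnmP/(_ x) := E; rewrite mnmDE mulmnE wE (negPf xi) mul0n.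
left; apply/mnmP => x; have /mnmP/(_ x) := E.
have := mnm_lepP sm x; have := mnm_lepP tm x.
rewrite (usum0 s m1 sm) ?(usum0 t m2 tm); try by move=> y /zero; lia.
rewrite mulmnD !mnmDE; move: ((w i *+ size s)%MM x) ((w i *+ size t)%MM x) => y z; lia.
Qed.

Lemma exchange_of_tame : tame (monomial_gen k w) -> exchange W /\ unique_exchange W.
Proof.
move=> tameI.
have complete i m : irreducible_exponent w i m -> exists c, m = chart_exponent w W i c.
  move=> irr; apply: contrapT => /forallNP new.
  (* A further irreducible exponent besides the [n] chart exponents would make [n + 1] of them, too
     many for a regular stalk. *)
  pose e x := if x is Some c then chart_exponent w W i c else m.
  have e_inj : injective e.
    move=> [c|] [c'|] //= E; first by congr Some; apply: chart_exponent_inj E.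
      by have [] := new c (esym E).
    by have [] := new c' E.
  have := tameI _ (vertex_blowup_point k (@squarefree_pointed i)).
  rewrite blowup_stalkE => reg.
  have e_irr x : irreducible_exponent w i (e x).
    by case: x => [c|] //; apply: chart_exponent_irreducible.
  have := card_irreducible_le (@squarefree_pointed i) (@frac_const_inj _) e_inj e_irr reg.
  by rewrite card_option card_ord ltnn.
split=> i; first by case: (exchange_of_complete wE antiW (@complete i)).
by case: (exchange_of_complete wE antiW (@complete i)).
Qed.

End NecessityOfExchange.

(** * Polarization *)

Section ExchangeTransfer.
Variables (T T' : finType) (r : nat) (W : 'I_r -> {set T}) (V : 'I_r -> {set T'}).
Variable R : T -> T' -> Prop.
Hypotheses (RE : forall c j, R c j -> forall l, (c \in W l) = (j \in V l))
  (Rfun : forall c j j', R c j -> R c j' -> j = j').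
Hypotheses (RW : forall c i l, c \in W i -> c \notin W l -> exists j, R c j)
  (RV : forall j i l, j \in V i -> j \notin V l -> exists c, R c j).

Lemma edge_transfer g i d : W g :\: W i = [set d]%SET ->
  exists j, R d j /\ V g :\: V i = [set j]%SET.
Proof.
move=> gi; have [dg di] := setD1_mem gi; have [j dj] := RW dg di.
exists j; split=> //; apply/setP => y; rewrite !inE.
apply/andP/eqP => [[yi yg]|->]; last by rewrite -!(RE dj).
have [c cy] := RV yg yi; have := setD1P c gi.
by rewrite !(RE cy) yg yi => /esym/eqP cd; apply: (Rfun _ dj); rewrite -cd.
Qed.

End ExchangeTransfer.

(** [R] is a partial bijection that preserves membership. The conditions only concern elements that
    lie in some sets and not in others, and [R] matches all of these. *)
Lemma exchange_transfer (T T' : finType) r (W : 'I_r -> {set T}) (V : 'I_r -> {set T'})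
    (R : T -> T' -> Prop) :
  (forall c j, R c j -> forall l, (c \in W l) = (j \in V l)) ->
  (forall c j j', R c j -> R c j' -> j = j') ->
  (forall c c' j, R c j -> R c' j -> c = c') ->
  (forall c i l, c \in W i -> c \notin W l -> exists j, R c j) ->
  (forall j i l, j \in V i -> j \notin V l -> exists c, R c j) ->
  exchange W /\ unique_exchange W -> exchange V /\ unique_exchange V.
Proof.
move=> RE Rfun Rinj RW RV [exW unW]; split.
  move=> i l j ji jl; have [c cj] := RV j i l ji jl.
  have [||g [d [gi dl cg]]] := exW i l c; rewrite ?(RE _ _ cj) //.
  have [j' [dj' gi']] := edge_transfer RE Rfun RW RV gi.
  by exists g, j'; rewrite -(RE _ _ dj') -(RE _ _ cj).
move=> i g g' j gi gi'.
pose R' j c := R c j.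
have back h : V h :\: V i = [set j]%SET -> exists c, R' j c /\ W h :\: W i = [set c]%SET.
  apply: (@edge_transfer _ _ _ V W R') => // [j0 c Rjc l|j0 c c' Rc Rc'].
    exact/esym/RE.
  exact: Rinj Rc Rc'.
have [[c [cj gc]] [c' [c'j gc']]] := (back g gi, back g' gi').
by apply: (unW i g g' c) => //; rewrite gc' (Rinj _ _ _ c'j cj).
Qed.

Section PolarizationExponents.
Variables (n r : nat) (u : 'I_r -> 'X_{1..n}).
Hypothesis anti_u : forall i g, (u g <= u i)%MM -> g = i.
Local Notation N := (pol_nvars u).

(** The variable x_j gets level 1 and Y_{j,t} gets level [t], so that a variable of level [t]
    divides the polarized generator exactly when [t] is at most the exponent of x_j. *)
Definition variable_level (p : pol_index u) : 'I_n * nat :=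
  match p with
  | inl j => (j, 1%N)
  | inr q => (tag q, (tagged q).+2)
  end.

Lemma variable_level_inj : injective variable_level.
Proof.
move=> [j|[j l]] [j'|[j' l']] //= [].
  by move->.
by move=> jj'; subst j' => /val_inj ->.
Qed.

Lemma max_exponent_ge l j : (u l j <= max_exponent u j)%N.
Proof. exact: (leq_bigmax (F := fun l => u l j)). Qed.

Lemma variable_level_ex l j t : (0 < t <= u l j)%N ->
  exists c : 'I_N, variable_level (enum_val c) = (j, t).
Proof.
case: t => // -[_|t /= tu].
  by exists (enum_rank (inl j : pol_index u)); rewrite enum_rankK.
have tm : (t < (max_exponent u j).-1)%N by have := max_exponent_ge l j; lia.
by exists (enum_rank (inr (existT _ j (Ordinal tm)) : pol_index u)); rewrite enum_rankK.
Qed.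

Definition pol_support l : {set 'I_N} :=
  [set c | (let jt := variable_level (enum_val c) in jt.2 <= u l jt.1)%N]%SET.

Definition pol_exponent l : 'X_{1..N} := [multinom (c \in pol_support l : nat) | c < N].

Lemma pol_monomialE (k : fieldType) l : pol_monomial u k l = 'X_[pol_exponent l].
Proof.
rewrite mpolyXE_id (reindex (fun p : pol_index u => enum_rank p)) /=; last first.
  exact: onW_bij (enum_rank_bij _).
rewrite big_sumType /= /pol_monomial big_split /=; congr (_ * _).
  apply: eq_bigr => j _; rewrite /pol_x mnmE inE enum_rankK /=.
  by congr (_ ^+ _); case: (u l j) => [|[|m]].
rewrite (sig_big_dep (J := fun j => 'I_(max_exponent u j).-1) xpredT
  (fun j (t : 'I_(max_exponent u j).-1) => (t.+2 <= u l j)%N) (fun j t => pol_Y u k j t)) /=.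
rewrite big_mkcond; apply: eq_bigr => -[j t] _ /=.
by rewrite mnmE inE enum_rankK /=; case: ifP => _; rewrite ?expr1 ?expr0.
Qed.

Lemma polarizationE (k : fieldType) : polarization u k = monomial_gen k pol_exponent.
Proof.
have E : pol_monomial u k = (fun l => 'X_[pol_exponent l]).
  by apply/funext => l; rewrite pol_monomialE.
by rewrite /polarization E.
Qed.

Lemma pol_antichain : antichain pol_support.
Proof.
move=> i g /fintype.subsetP gi; apply: anti_u; apply/mnm_lepP => j.
have [->//|u0] := posnP (u g j).
have [|c cE] := @variable_level_ex g j (u g j); first by rewrite u0 leqnn.
by have := gi c; rewrite !inE cE /=; apply.
Qed.

Lemma pol_exponentE l c : pol_exponent l c = (c \in pol_support l).
Proof. by rewrite mnmE. Qed.

Lemma exchange_gap : exchange pol_support ->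
  forall l l' j, (u l j <= (u l' j).+1)%N.
Proof.
move=> exW l l' j; rewrite leqNgt; apply/negP => gap.
(* The two highest levels of x_j in generator [l]. The gap keeps [y] out of the support of [l'], and
   a support without [y] cannot contain [z]. *)
have [|y yE] := @variable_level_ex l j (u l j).-1; first lia.
have [|z zE] := @variable_level_ex l j (u l j); first lia.
have [||g [d [gl _ yg]]] := exW l l' y; rewrite ?inE ?yE /=; try lia.
have [e lg] := exchange_swap pol_antichain exW gl.
move: yg; rewrite inE yE /= -ltnNge => yg.
have ye : y = e by apply/eqP; rewrite -(setD1P y lg) !inE yE /=; lia.
have ze : z = e by apply/eqP; rewrite -(setD1P z lg) !inE zE /=; lia.
by have : (j, (u l j).-1) = (j, u l j); [rewrite -yE -zE ye ze|case; lia].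
Qed.

Lemma exchange_base : exchange pol_support ->
  exists m : 'X_{1..n}, forall l j, u l j = (m j + (m j < u l j))%N.
Proof.
move=> /exchange_gap gap.
have [l0|none] := pselect (exists l : 'I_r, True); last first.
  by exists 0%MM => l; case: none; exists l.
exists [multinom u [arg min_(l < sval (cid l0)) u l j]%N j | j < n] => l j; rewrite mnmE.
case: arg_minnP => // a _ amin; have := amin l isT; have := gap l a j.
by case: ltnP; lia.
Qed.

Section Base.
Variables (m : 'X_{1..n}) (V : 'I_r -> {set 'I_n}).
Hypothesis uE : forall l j, u l j = (m j + (j \in V l))%N.

(** The generators can differ only at level [m j + 1] of x_j: lower levels belong to all supports
    and higher ones to none. *)
Let R (c : 'I_N) (j : 'I_n) : Prop := variable_level (enum_val c) = (j, (m j).+1).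

Let RE c j : R c j -> forall l, (c \in pol_support l) = (j \in V l).
Proof. by move=> cE l; rewrite inE cE /= uE; case: (j \in V l); lia. Qed.

Let Rfun c j j' : R c j -> R c j' -> j = j'.
Proof. by move=> cE; rewrite /R cE => -[]. Qed.

Let Rinj c c' j : R c j -> R c' j -> c = c'.
Proof. by move=> cE c'E; apply/enum_val_inj/variable_level_inj; rewrite cE c'E. Qed.

Let RW c i l : c \in pol_support i -> c \notin pol_support l -> exists j, R c j.
Proof.
rewrite !inE /R; case: (variable_level _) => j t /=; rewrite !uE => ti tl; exists j.
by congr pair; move: ti tl; case: (j \in V i); case: (j \in V l); lia.
Qed.

Let RV j i l : j \in V i -> j \notin V l -> exists c, R c j.
Proof.
move=> ji _; apply: (@variable_level_ex i); rewrite uE ji; lia.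
Qed.

Lemma exchange_pol_base :
  exchange pol_support /\ unique_exchange pol_support -> exchange V /\ unique_exchange V.
Proof. exact: exchange_transfer RE Rfun Rinj RW RV. Qed.

Lemma exchange_base_pol :
  exchange V /\ unique_exchange V -> exchange pol_support /\ unique_exchange pol_support.
Proof.
apply: (@exchange_transfer _ _ _ V pol_support (fun j c => R c j)) => //.
- by move=> j c jc l; rewrite -(RE jc).
- by move=> j c c'; apply: Rinj.
- by move=> j j' c; apply: Rfun.
Qed.

Lemma base_antichain : antichain V.
Proof.
move=> i g /fintype.subsetP gi; apply: anti_u; apply/mnm_lepP => j; rewrite !uE leq_add2l.
by have := gi j; case: (j \in V g) => // ->.
Qed.

End Base.
End PolarizationExponents.

(** * Monomial multiples of squarefree ideals *)

Section ScaledIdeals.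
Variables (k : fieldType) (n : nat).
Local Notation R := {mpoly k[n]}.

Lemma ideal_gen_scale (a : R) (E : set R) :
  ideal_gen [set a * x | x in E] = [set a * x | x in ideal_gen E].
Proof.
have iE := ideal_gen_ideal E; have iaE := ideal_gen_ideal [set a * x | x in E].
apply/seteqP; split.
  apply: ideal_gen_min => [|_ [x Ex <-]]; last by exists x => //; apply: mem_ideal_gen.
  split=> //; first by exists 0; [exact: ideal0 iE|rewrite mulr0].
    move=> _ _ [x Ix <-] [y Iy <-]; exists (x + y); last by rewrite mulrDr.
    exact: (idealD iE).
  by move=> b _ _ [x Ix <-]; exists (b * x); [exact: (idealMl iE)|rewrite mulrCA].
move=> _ [x Ix <-]; pose J := [set x | ideal_gen [set a * x | x in E] (a * x)].
apply: (ideal_gen_min (J := J)) Ix => [|y Ey]; last by apply: mem_ideal_gen; exists y.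
split=> //=; rewrite /J /=.
- by rewrite mulr0; apply: ideal0 iaE.
- by move=> y z; rewrite mulrDr; apply: (idealD iaE).
- by move=> b y _; rewrite mulrCA; apply: (idealMl iaE).
Qed.

Lemma monomial_gen_scale r (u v : 'I_r -> 'X_{1..n}) m :
  (forall l, u l = (m + v l)%MM) ->
  monomial_gen k u = [set 'X_[m] * x | x in monomial_gen k v].
Proof.
move=> uE; rewrite -ideal_gen_scale image_comp /monomial_gen.
have -> // : (fun l => 'X_[u l]) = ( *%R ('X_[m] : R)) \o (fun l => 'X_[v l]).
by apply/funext => l; rewrite /= uE mpolyXD.
Qed.

Lemma monomial_gen_squarefree r (v : 'I_r -> 'X_{1..n}) (V : 'I_r -> {set 'I_n}) :
  (forall l j, v l j = (j \in V l)) -> squarefree_monomial_ideal (monomial_gen k v).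
Proof.
move=> vE; exists (range v); split=> [_ [l _ <-] j|]; first by rewrite vE leq_b1.
by rewrite image_comp.
Qed.

Lemma minimal_generators_antichain (I : set R) r (u : 'I_r -> 'X_{1..n}) :
  minimal_monomial_generators I u -> forall i g, (u g <= u i)%MM -> g = i.
Proof.
move=> [_ umin] i g ugi; apply: contrapT => gi; apply: (umin i).
rewrite -(submK ugi) mpolyXD; apply: (idealMl (ideal_gen_ideal _)) => //.
by apply: mem_ideal_gen; exists g => //; apply/eqP.
Qed.

(** The minimal generators of [I] are the multiples by [m] of some of the squarefree generators of
    [I'], and these already generate [I']. *)
Lemma squarefree_quotient (I I' : set R) r (u : 'I_r -> 'X_{1..n}) m :
  minimal_monomial_generators I u -> squarefree_monomial_ideal I' ->
  I = [set 'X_[m] * x | x in I'] ->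
  exists v : 'I_r -> 'X_{1..n}, [/\ forall l, u l = (m + v l)%MM,
    forall l j, v l j = (j \in [set j | (0 < v l j)%N]%SET) & I' = monomial_gen k v].
Proof.
move=> hu [M [Msq I'E]] IE; have anti_u := minimal_generators_antichain hu.
have IuE : I = monomial_gen k u by case: hu.
have I'M m' : M m' -> I' 'X_[m'].
  by move=> Mm'; rewrite I'E; apply: mem_ideal_gen; exists m'.
have I_le m' : M m' -> exists l, (u l <= m + m')%MM.
  move=> Mm'; have : I ('X_[m] * 'X_[m']) by rewrite IE; exists 'X_[m'] => //; apply: I'M.
  rewrite IuE -mpolyXD => /monomial_gen_supp; apply.
  by rewrite msuppX inE.
have /choice[v vP] : forall l, exists m', M m' /\ u l = (m + m')%MM.
  move=> l; have : I 'X_[u l] by rewrite IuE; apply: monomial_gen_gen.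
  rewrite IE => -[x I'x xE]; have : u l \in msupp ('X_[m] * x : R).
    by rewrite xE msuppX inE.
  case/msuppM_le/allpairsP => -[m1 m2] /= []; rewrite msuppX inE => /eqP -> m2x ulE.
  rewrite I'E in I'x; have [m' Mm' m'm2] := monomial_ideal_supp I'x m2x.
  exists m'; split=> //; have [l' l'm] := I_le m' Mm'.
  have mm : (m + m' <= u l)%MM.
    by rewrite ulE; apply/mnm_lepP => j; rewrite !mnmDE leq_add2l; apply/mnm_lepP.
  (* The monomial of exponent [m + m'] is in [I], hence above some [u l'], and it is below [u l];
     minimality makes all three equal. *)
  have ll' := anti_u _ _ (lepm_trans l'm mm); rewrite ll' in l'm.
  by apply/mnmP => j; apply/eqP; rewrite eqn_leq (mnm_lepP l'm) (mnm_lepP mm).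
exists v; split=> [l|l j|]; first by case: (vP l).
  by rewrite inE; have := Msq _ (vP l).1 j; case: (v l j) => [|[]].
apply/seteqP; split; last first.
  rewrite I'E; apply: ideal_gen_min => [|_ [l _ <-]]; first exact: ideal_gen_ideal.
  by rewrite -I'E; apply/I'M; case: (vP l).
rewrite I'E; apply: ideal_gen_min => [|_ [m' Mm' <-]]; first exact: ideal_gen_ideal.
have [l lm'] := I_le m' Mm'; have vm' : (v l <= m')%MM.
  apply/mnm_lepP => j; have := mnm_lepP lm' j.
  by rewrite (vP l).2 !mnmDE leq_add2l.
rewrite -(submK vm') mpolyXD; apply: (idealMl (ideal_gen_ideal _)) => //.
exact: monomial_gen_gen.
Qed.

End ScaledIdeals.

Theorem proposition2p13 (k : closedFieldType) (n : nat)
    (I : set {mpoly k[n]}) (hI : monomial_ideal I)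
    (r : nat) (u : 'I_r -> 'X_{1..n})
    (hu : minimal_monomial_generators I u) :
  ((tame (polarization u k) /\ squarefree_monomial_ideal (polarization u k))
   <->
   (exists (m : 'X_{1..n}) (I' : set {mpoly k[n]}),
      [/\ tame I', squarefree_monomial_ideal I'
        & I = [set 'X_[m] * x | x in I']]))
  /\ (tame (polarization u k) -> tame I).
Proof.

have anti_u := minimal_generators_antichain hu; have polanti := pol_antichain anti_u.
have IuE : I = monomial_gen k u by case: hu.
have polE := @pol_exponentE _ _ u.
(* Tameness of the polarization alone gives the exchange conditions, hence the form u I'; both (ii)
   and the final implication start from here. *)
have decompose : tame (polarization u k) -> exists (m : 'X_{1..n}) (V : 'I_r -> {set 'I_n}),
    (forall l j, u l j = (m j + (j \in V l))%N) /\ (exchange V /\ unique_exchange V).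
  rewrite polarizationE => /(exchange_of_tame polE polanti) exW.
  have [m mE] := exchange_base anti_u exW.1.
  pose V l := [set j | (m j < u l j)%N]%SET.
  have uE l j : u l j = (m j + (j \in V l))%N by rewrite inE -mE.
  by exists m, V; split=> //; apply: exchange_pol_base uE exW.
split; first split.
- case=> /decompose[m [V [uE [exV unV]]]] _.
  pose v l : 'X_{1..n} := [multinom (j \in V l : nat) | j < n].
  have vE l j : v l j = (j \in V l) by rewrite mnmE.
  exists m, (monomial_gen k v); split.
  + apply: (tame_of_exchange (m0 := 0%MM) _ (base_antichain anti_u uE) exV unV).
    by move=> l j; rewrite mnm0E vE.
  + exact: monomial_gen_squarefree vE.
  rewrite IuE; apply: monomial_gen_scale => l.
  by apply/mnmP => j; rewrite mnmDE vE uE.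
- case=> m [I' [tameI' sqI' IE]]; have [v [umv vE I'E]] := squarefree_quotient hu sqI' IE.
  have uE l j : u l j = (m j + (j \in [set j | (0 < v l j)%N]%SET))%N.
    by rewrite umv mnmDE -vE.
  rewrite I'E in tameI'; have exV := exchange_of_tame vE (base_antichain anti_u uE) tameI'.
  have [exW unW] := exchange_base_pol uE exV.
  rewrite polarizationE; split; last exact: monomial_gen_squarefree polE.
  apply: (tame_of_exchange (m0 := 0%MM) _ polanti exW unW) => l c.
  by rewrite mnm0E polE.
(* The charts are polynomial rings for any common factor, so [I] itself is handled with [m0 = m]. *)
case/decompose=> m [V [uE [exV unV]]]; rewrite IuE.
exact: (tame_of_exchange uE (base_antichain anti_u uE) exV unV).
Qed.
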